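(* If $\mathfrak{c}=\aleph_\alpha$ then there are exactly $|\alpha|\cdot\aleph_0$-many Tukey types of $\mathbf{seq}(M)$, where $M$ ranges over separable metrizable spaces. In particular: (0) there are at least $\aleph_0$-many and no more than $\mathfrak{c}$-many Tukey types of $\mathbf{seq}(M)$, $M$ separable metrizable; (1) there are countably many Tukey types of $\mathbf{seq}(M)$, $M$ separable metrizable, if and only if $\mathfrak{c}<\aleph_{\omega_1}$; and (2) there are continuum, $\mathfrak{c}$, many Tukey types of $\mathbf{seq}(M)$, $M$ separable metrizable, if and only if $\mathfrak{c}$ is a fixed point of the aleph function with uncountable cofinality. Hence the first cardinal value of $\mathfrak{c}$ for which there are $\mathfrak{c}$-many types is the $\omega_1$st fixed point of the aleph function.
   Context: A relation is a triple $\mathbf{A}=(A_-,A_+,A)$ of sets $A_-,A_+$ and a binary predicate $xAy$ for $x\in A_-$, $y\in A_+$. A (Tukey) morphism from $\mathbf{A}$ to $\mathbf{B}$ is a pair $(\psi_-,\phi_+)$ of functions $\psi_-:B_-\to A_-$, $\phi_+:A_+\to B_+$ such that $\psi_-(b)\,A\,a$ implies $b\,B\,\phi_+(a)$ for all $b\in B_-$, $a\in A_+$. Write $\mathbf{A}\ge_T\mathbf{B}$ if there is such a morphism, $\mathbf{A}=_T\mathbf{B}$ if $\mathbf{A}\ge_T\mathbf{B}$ and $\mathbf{B}\ge_T\mathbf{A}$. Tukey types are $=_T$-classes. For a space $X$: $\mathrm{NC}(X)$ is the set of non-closed subsets; $\mathrm{CS}^+(X)=\{e(\omega+1): e \text{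 an embedding of the space }\omega+1\text{ into }X\}$ (infinite convergent sequences with limit); $S\,(\neg c)\,T$ means $S\cap T$ is not closed in $T$; $\mathbf{seq}(X)=(\mathrm{NC}(X),\mathrm{CS}^+(X),\neg c)$. $\mathfrak{c}$ is the cardinality of the continuum. A fixed point of the aleph function is a cardinal $\kappa$ with $\kappa=\aleph_\kappa$. *)

(* Defs.v *)
From HB Require Import structures.
From mathcomp Require Export all_boot all_order all_algebra.
From mathcomp Require Export all_classical all_reals topology.
From mathcomp Require Export wochoice.

Set Implicit Arguments.
Unset Strict Implicit.
Unset Printing Implicit Defensive.

Import Order.TTheory GRing.Theory Num.Theory.

Local Open Scope classical_set_scope.
Local Open Scope card_scope.
Local Open Scope ring_scope.

Record tukey_rel := TukeyRel {
  neg : Type;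
  pos : Type;
  holds : neg -> pos -> Prop }.

Definition tukey_ge (A B : tukey_rel) : Prop :=
  exists (psi : neg B -> neg A) (phi : pos A -> pos B),
    forall (b : neg B) (a : pos A), holds (psi b) a -> holds b (phi a).

Definition tukey_eq (A B : tukey_rel) : Prop := tukey_ge A B /\ tukey_ge B A.

Definition tukey_type (A : tukey_rel) : tukey_rel -> Prop :=
  fun B => tukey_eq A B.

Definition embedding (X Y : topologicalType) (e : X -> Y) : Prop :=
  injective e /\
  forall U : set X, open U <-> exists2 V : set Y, open V & U = e @^-1` V.

(** The ordinal space omega + 1 is the one-point compactification of the
    discrete space omega. *)
Definition omega_plus_one : topologicalType := one_point_compactification nat.

Definition NC (X : topologicalType) : Type := {S : set X | ~ closed S}.

Definition CSplus (X : topologicalType) : Type :=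
  {T : set X | exists2 e : omega_plus_one -> X, embedding e & T = range e}.

(** [subspace T] has carrier all of [X], with the points outside [T] isolated;
    hence a subset of [T] is closed in it iff it is relatively closed in [T]. *)
Definition not_closed_in (X : topologicalType) (S T : set X) : Prop :=
  ~ closed (S `&` T : set (subspace T)).

Definition seq_rel (X : topologicalType) : tukey_rel :=
  @TukeyRel (NC X) (CSplus X) (fun S T => not_closed_in (sval S) (sval T)).

Definition is_metric (R : realType) (X : Type) (d : X -> X -> R) : Prop :=
  [/\ forall x y, 0 <= d x y,
      forall x y, d x y = 0 <-> x = y,
      forall x y, d x y = d y x &
      forall x y z, d x z <= d x y + d y z].

Definition metrizable (R : realType) (X : topologicalType) : Prop :=
  exists2 d : X -> X -> R, is_metric d &
    forall U : set X, open U <->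
      forall x, U x -> exists2 r : R, 0 < r & forall y, d x y < r -> U y.

Definition separable (X : topologicalType) : Prop :=
  exists2 D : set X, countable D & dense D.

Definition seq_tukey_type (R : realType) (C : tukey_rel -> Prop) : Prop :=
  exists M : topologicalType,
    [/\ separable M, metrizable R M & C = tukey_type (seq_rel M)].

(** There are exactly [#|K|] Tukey types of seq(M), M separable metrizable.
    The bijection is spelled out, rather than stated with [#=], to keep the
    universe of [tukey_rel] above, and not below, that of [set]. *)
Definition number_of_seq_types (R : realType) (K : Type) : Prop :=
  exists t : K -> (tukey_rel -> Prop),
    (forall k l, t k = t l -> k = l) /\
    (forall C, seq_tukey_type R C <-> exists k, C = t k).

(** A cardinal is represented by a type, up to equinumerosity [#=]; an ordinal
    by a well-ordered type, up to isomorphism. *)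

Definition card_lt (K L : Type) : Prop :=
  [set: K] #<= [set: L] /\ ~ ([set: L] #<= [set: K]).

Definition least_cardinal (P : Type -> Prop) (K : Type) : Prop :=
  P K /\ forall L : Type, P L -> [set: K] #<= [set: L].

Record wellOrder := WellOrder {
  wo_sort :> Type;
  wo_le : rel wo_sort;
  wo_leP : well_order wo_le }.

Definition wo_lt (W : wellOrder) (v w : W) : Prop := wo_le v w /\ v <> w.

(** [K] is the [W]-th cardinal with property [P], counting from 0: it is the
    least one that exceeds the [v]-th such cardinal for all [v] in [W]. *)
Definition nth_cardinal (P : Type -> Prop) (W : wellOrder) (K : Type) : Prop :=
  exists F : W -> Type,
    (forall w, least_cardinal
       (fun L => P L /\ forall v, wo_lt v w -> card_lt (F v) L) (F w)) /\
    least_cardinal (fun L => P L /\ forall v, card_lt (F v) L) K.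

Definition is_aleph : wellOrder -> Type -> Prop :=
  nth_cardinal (fun L => infinite_set [set: L]).

Definition initial_ordinal_of (K : Type) (W : wellOrder) : Prop :=
  [set: W] #= [set: K] /\
  forall w : W, ~ ([set: W] #<= [set v : W | wo_lt v w]).

Definition is_omega1 (W : wellOrder) : Prop :=
  ~ countable [set: W] /\ forall w : W, countable [set v : W | wo_lt v w].

Definition aleph_fixed_point (K : Type) : Prop :=
  infinite_set [set: K] /\
  exists2 W : wellOrder, initial_ordinal_of K W & is_aleph W K.

Definition cofinal (W : wellOrder) (S : set W) : Prop :=
  forall w : W, exists2 s, S s & wo_le w s.

Definition is_cofinality (W : wellOrder) (L : Type) : Prop :=
  (exists2 S : set W, cofinal S & S #= [set: L]) /\
  (forall S : set W, cofinal S -> [set: L] #<= S).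

Definition uncountable_cofinality (K : Type) : Prop :=
  exists W : wellOrder, initial_ordinal_of K W /\
    exists2 L : Type, is_cofinality W L & ~ countable [set: L].

Definition lt_aleph_omega1 (K : Type) : Prop :=
  exists (W : wellOrder) (L : Type),
    [/\ is_omega1 W, is_aleph W L & card_lt K L].

Definition omega1st_aleph_fixed_point (K : Type) : Prop :=
  exists2 W : wellOrder, is_omega1 W & nth_cardinal aleph_fixed_point W K.

(* Main.v *)
From HB Require Import structures.
From Stdlib Require Eqdep_dec.
From mathcomp Require Import lra.
Require Import Defs.

Set Implicit Arguments.
Unset Strict Implicit.
Unset Printing Implicit Defensive.

Import Order.TTheory GRing.Theory Num.Theory.

Local Open Scope classical_set_scope.
Local Open Scope card_scope.

(** Why the theorem is true.

    A set [S] in a metrizable space fails to be closed in a convergent sequence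
    [T] exactly when it misses the limit of [T] and contains infinitely many of
    its terms. Since every non-closed set contains a sequence that converges to
    a point outside it, seq(M) is Tukey equivalent to the relation of sequences
    whose challenges and answers are nontrivial convergent sequences, an answer
    being correct if it has the same limit as the challenge and infinitely many
    terms in common with it ([seq_rel_eq_sequence_rel]). This relation is a sum
    of local relations, one for each accumulation point.

    Lower bound. Two challenges at one point have a common answer, and two
    challenges at distinct points have none; so the number of accumulation
    points is an invariant of the Tukey type ([accumulation_card_le]). Keeping
    from the plane a dyadic grid that accumulates at the horizontal axis, and a
    set [S] of points on that axis, gives a separable metrizable space with [S]
    as its set of accumulation points ([grid_accumulation]). Hence there are at
    least as many types as there are cardinals up to that of the continuum.

    Upper bound. Near an accumulation point [x] cut the space into annuli.
    Convergence to [x] depends only on the cardinalities of the annuli, and a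
    map of annuli into disjoint blocks of annuli around [y] compares the local
    relations. It exists as soon as the local type of [x], the least cardinality
    of a neighbourhood together with the information whether single annuli
    attain it, is at most that of [y] ([local_le_small]). Local types are
    well-ordered. The profile of a space counts, for each local type, the
    accumulation points of that type or above. Spaces with the same profile have
    the same Tukey type, because accumulation points can be matched injectively
    without decreasing the local type ([nested_hall]). A profile is a
    nonincreasing function between well-orders, hence a step function with
    finitely many steps, and so there are no more profiles than cardinals up to
    that of the continuum ([card_nonincreasing_le]).

    So there are exactly as many types as cardinals up to the continuum
    ([number_of_seq_types_cards]), and the rest is cardinal arithmetic. If the
    continuum is the [alpha]-th aleph, these cardinals are the finite ones and
    the alephs up to [alpha] ([cards_aleph]). An infinite cardinal is a fixed
    point of the aleph function iff there are as many infinite cardinals up to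
    it as it has elements ([aleph_fixed_pointP]); the cofinality of the
    continuum is uncountable by the theorem of König. Above any cardinal there
    is a fixed point of countable cofinality which any larger fixed point of
    uncountable cofinality exceeds ([fixed_point_above]); it follows that the
    first fixed point of uncountable cofinality is the [omega_1]-st one. *)

(** * Comparing cardinalities *)

Lemma card_le_intro (T U : Type) (A : set T) (B : set U) (f : T -> U) :
  (forall x, A x -> B (f x)) ->
  (forall x y, A x -> A y -> f x = f y -> x = y) -> A #<= B.
Proof.
move=> fAB finj.
have i : {in A &, injective f} by move=> x y /set_mem Ax /set_mem Ay; exact: finj.
apply: (card_le_trans (B := f @` A)); last by apply: subset_card_le => _ [x Ax <-]; exact: fAB.
by have := inj_card_eq i; rewrite card_eq_le => /andP[].
Qed.

(** The point of [U] is a default value off [A]. *)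
Lemma card_le_elim (T U : Type) (A : set T) (B : set U) :
  A #<= B -> U -> exists f : T -> U,
    (forall x, A x -> B (f x)) /\ (forall x y, A x -> A y -> f x = f y -> x = y).
Proof.
move=> /card_leP[g] u0.
have mA x : A x -> x \in A by move=> ?; exact/mem_set.
exists (fun x => if pselect (A x) is left h then val (g (SigSub (mA _ h))) else u0).
split => [x Ax|x y Ax Ay].
  by case: pselect => // h; exact/set_mem/valP.
case: pselect => // h; case: pselect => // h' /val_inj /inj.
by move=> /(_ (mem_set I) (mem_set I)) [].
Qed.

Lemma card_leTE (K L : Type) :
  ([set: K] #<= [set: L]) <-> exists f : K -> L, injective f.
Proof.
split => [KL|[f fi]]; last by apply: (card_le_intro (f := f)) => // x y _ _; exact: fi.
have [[l]|nL] := pselect (inhabited L).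
  by have [f [_ fi]] := card_le_elim KL l; exists f => x y; exact: fi.
have nK (k : K) : False.
  have L0 : [set: L] = set0 by apply/seteqP; split => // l; case: nL.
  by move: KL; rewrite L0 card_le0 => /eqP/seteqP[/(_ k I)].
by exists (fun k => match nK k with end) => x; case: (nK x).
Qed.

Lemma card_eqTE (K L : Type) : [set: K] #= [set: L] <->
  exists f : K -> L, injective f /\ (forall l, exists k, f k = l).
Proof.
split=> [/card_bijP[f fb]|[f [fi fs]]].
  have /= mT (T : Type) (x : T) : x \in [set: T] by exact: mem_set.
  exists (fun k => val (f (SigSub (mT _ k)))); split.
    by move=> x y /val_inj /(bij_inj fb) [].
  move=> l; have [g fg gf] := fb; exists (val (g (SigSub (mT _ l)))).
  rewrite (_ : SigSub _ = g (SigSub (mT _ l))) ?gf //.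
  exact: val_inj.
rewrite card_eq_le; apply/andP; split; apply/card_leTE; first by exists f.
have [g gf] := choice fs; exists g => x y exy.
by rewrite -(gf x) -(gf y) exy.
Qed.

Lemma card_surj (T U : Type) (A : set T) (B : set U) (f : T -> U) :
  (forall y, B y -> exists2 x, A x & f x = y) -> B #<= A.
Proof.
move=> fs; apply: (card_le_trans (B := f @` A)); last exact: card_image_le.
by apply: subset_card_le => y /fs[x Ax <-]; exists x.
Qed.

Lemma card_eqLR (T U : Type) (A : set T) (B : set U) :
  A #<= B -> B #<= A -> A #= B.
Proof. by move=> ab ba; rewrite card_eq_le ab ba. Qed.

Lemma card_eqL (T U : Type) (A : set T) (B : set U) : A #= B -> A #<= B.
Proof. by rewrite card_eq_le => /andP[]. Qed.

Lemma card_eqR (T U : Type) (A : set T) (B : set U) : A #= B -> B #<= A.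
Proof. by rewrite card_eq_le => /andP[]. Qed.

Lemma card_sigT (T : Type) (P : set T) : [set: {x | P x}] #= P.
Proof.
rewrite card_eq_le; apply/andP; split.
  apply: (card_le_intro (f := sval)) => [x _|x y _ _]; first exact: svalP.
  by case: x y => x px [y py] /= e; apply: eq_exist.
have le := card_eqR (card_setT P).
apply: (card_le_trans le); apply/card_leTE.
exists (fun u : set_type P => exist P (val u) (set_mem (valP u))) => u v [].
exact: val_inj.
Qed.

(** * Well-orders and greedy choices *)

(** Transitivity follows, see [strict_wo_trans]: its failure would be a cycle
    without a minimal element. *)
Definition strict_wo (W : Type) (lt : W -> W -> Prop) : Prop :=
  (forall P : set W, P !=set0 -> exists2 m, P m & forall x, P x -> ~ lt x m) /\
  (forall x y, x <> y -> lt x y \/ lt y x).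

Lemma strict_wo_wf (W : Type) (lt : W -> W -> Prop) :
  strict_wo lt -> well_founded lt.
Proof.
move=> [lmin _] x; apply: contrapT => nx.
have [m nm mmin] := lmin (fun x => ~ Acc lt x) (ex_intro _ x nx).
by apply: nm; constructor => y ym; apply: contrapT => /mmin.
Qed.

Lemma strict_wo_min (W : Type) (lt : W -> W -> Prop) : strict_wo lt ->
  forall P : set W, P !=set0 -> exists2 m, P m & forall x, P x -> x = m \/ lt m x.
Proof.
move=> [lmin ltot] P /lmin[m Pm mP]; exists m => // x Px.
have [->|/ltot[/(mP x Px)|]] := pselect (x = m); by [left|right|].
Qed.

Lemma strict_wo_sub (W : Type) (lt : W -> W -> Prop) (D : set W) :
  strict_wo lt -> strict_wo (fun x y : {x | D x} => lt (sval x) (sval y)).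
Proof.
move=> [lmin ltot]; split.
  move=> P [x Px]; have [|_ [m Pm <-] mP] := lmin (sval @` P).
    by exists (sval x); exists x.
  by exists m => // y Py; apply: mP; exists y.
move=> x y xy; apply: ltot => e; apply: xy.
by case: x y e => x dx [y dy] /= e; apply: eq_exist.
Qed.

Lemma strict_wo_irr (W : Type) (lt : W -> W -> Prop) x : strict_wo lt -> ~ lt x x.
Proof.
by move=> wo; have [m -> mP] := wo.1 [set x] (ex_intro _ x erefl); exact: mP.
Qed.

Lemma strict_wo_trans (W : Type) (lt : W -> W -> Prop) x y z : strict_wo lt ->
  lt x y -> lt y z -> lt x z.
Proof.
move=> wo xy yz; apply: contrapT => nxz.
have zx : lt z x \/ z = x.
  have [e|/(wo.2)[]//] := pselect (z = x); by [right|left].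
have [|m mm mP] := wo.1 (fun t => [\/ t = x, t = y | t = z]); first by exists x; constructor.
case: mm mP => -> mP.
- case: zx => [|e]; first by apply: mP; constructor.
  by rewrite e in yz; apply: (mP y) => //; constructor.
- by apply: (mP x) => //; constructor.
- by apply: (mP y) => //; constructor.
Qed.

(** The second component of the lexicographic order may depend on the value of
    the first, so that each class of [c] can be given an order of its own. *)
Lemma strict_wo_lexi (X W : Type) (c : X -> W) lt1 (lt2 : W -> X -> X -> Prop) :
  strict_wo lt1 -> (forall w, strict_wo (lt2 w)) ->
  strict_wo (fun x y : X => lt1 (c x) (c y) \/ (c x = c y /\ lt2 (c y) x y)).
Proof.
move=> [m1 t1] wo2; split.
  move=> P [x Px]; have [|_ [x1 Px1 <-] mx1] := m1 (c @` P).
    by exists (c x); exists x.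
  have [|m [Pm cm] mm] := (wo2 (c x1)).1 (fun y => P y /\ c y = c x1); first by exists x1.
  exists m => // y Py [|[cy]]; first by rewrite cm; apply: mx1; exists y.
  by rewrite cm; apply: mm; split=> //; rewrite cy.
move=> x y xy; have [cxy|] := pselect (c x = c y); last first.
  by move=> /t1[]; [left; left|right; left].
by have [] := (wo2 (c x)).2 x y xy; [left; right|right; right]; rewrite -?cxy.
Qed.

(** A transfinite greedy choice of distinct points [f w]: a point of [avail w]
    is left over at stage [w] since those already used are too few to exhaust
    [avail w]. *)
Lemma greedy_injection (W X : Type) (lt : W -> W -> Prop) (avail : W -> set X) :
  strict_wo lt ->
  (forall w, ~ (avail w #<= [set v | lt v w])) ->
  exists f : W -> X, (forall w, avail w (f w)) /\ injective f.
Proof.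
move=> wo big.
have [[w0]|nW] := pselect (inhabited W); last first.
  exists (fun w => match nW (inhabits w) with end).
  by split=> w; case: (nW (inhabits w)).
have [x0 _] : avail w0 !=set0.
  by apply/set0P/negP => /eqP e; apply: (big w0); rewrite e card_ge0.
pose step w (g : forall v, lt v w -> X) : X :=
  if pselect (exists x, avail w x /\ forall v (h : lt v w), g v h <> x) is left h
  then sval (cid h) else x0.
pose f := Fix (strict_wo_wf wo) (fun _ => X) step.
have fE w : f w = step w (fun v _ => f v).
  apply: Fix_eq => v g h gh.
  by congr step; do 2 apply: functional_extensionality_dep => ?.
have fP w : avail w (f w) /\ forall v, lt v w -> f v <> f w.
  rewrite fE /step; case: pselect => [h|nh]; first by case: (cid h).
  case: (big w); apply: (card_surj (f := f)) => x ax; apply: contrapT => nx.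
  by apply: nh; exists x; split => // v vw e; apply: nx; exists v.
exists f; split=> [w|v w e]; first by case: (fP w).
apply: contrapT => /(wo.2)[vw|wv]; first by have [_ /(_ _ vw)] := fP w.
by have [_ /(_ _ wv)] := fP v; rewrite e.
Qed.

Lemma greedy_card_le (W X : Type) (lt : W -> W -> Prop) (B : set X) :
  strict_wo lt -> (forall w, ~ (B #<= [set v | lt v w])) -> [set: W] #<= B.
Proof.
move=> wo big; have [f [fB fi]] := greedy_injection wo big.
by apply: (card_le_intro (f := f)) => // x y _ _; exact: fi.
Qed.

Lemma greedy_seg_le (W X : Type) (lt : W -> W -> Prop) (B : set X) (w : W) :
  strict_wo lt -> (forall v, lt v w -> ~ (B #<= [set u | lt u v])) ->
  [set v | lt v w] #<= B.
Proof.
move=> wo big; have le := card_eqR (card_sigT [set v | lt v w]).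
apply: (card_le_trans le).
apply: (greedy_card_le (strict_wo_sub [set v | lt v w] wo)) => -[v vw] /=.
move=> Bv; apply: (big v vw); apply: (card_le_trans Bv).
apply: (card_le_intro (f := sval)) => // -[x px] [y py] /= _ _ e.
exact: eq_exist.
Qed.

Section WellOrderFacts.
Variable W : wellOrder.

Lemma wo_minP (P : set W) : P !=set0 ->
  exists2 m, P m & forall x, P x -> wo_le m x.
Proof.
move=> [x Px]; have [|m [[Pm mP] _]] := @wo_leP W (fun x => `[<P x>]).
  by exists x; exact/asboolP.
by exists m; [exact/asboolP|move=> y Py; apply: mP; exact/asboolP].
Qed.

Lemma wo_le_total (x y : W) : wo_le x y \/ wo_le y x.
Proof.
have [|m [->|->] mP] := @wo_minP (fun z => z = x \/ z = y); first by exists x; left.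
  by left; apply: mP; right.
by right; apply: mP; left.
Qed.

Lemma wo_le_refl (x : W) : wo_le x x.
Proof. by have [] := wo_le_total x x. Qed.

Lemma wo_le_anti (x y : W) : wo_le x y -> wo_le y x -> x = y.
Proof.
move=> xy yx; have [|m [_ um]] := @wo_leP W (fun z => `[<z = x \/ z = y>]).
  by exists x; apply/asboolP; left.
transitivity m; [symmetry|]; apply: um; split; rewrite ?unfold_in; do ?[by apply/asboolP; auto];
  by move=> z /asboolP[]->; rewrite ?wo_le_refl.
Qed.

Lemma wo_le_trans (x y z : W) : wo_le x y -> wo_le y z -> wo_le x z.
Proof.
move=> xy yz; have [|m mm mP] := @wo_minP (fun t => [\/ t = x, t = y | t = z]).
  by exists x; constructor.
have [mx my mz] : [/\ wo_le m x, wo_le m y & wo_le m z].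
  by split; apply: mP; [constructor 1|constructor 2|constructor 3].
case: mm mx my mz => [->//|->|->] mx my mz.
  by rewrite (wo_le_anti xy mx).
by rewrite (wo_le_anti yz my) in xy *.
Qed.

Lemma wo_lt_strict : strict_wo (@wo_lt W).
Proof.
split=> [P /wo_minP[m Pm mP]|x y xy].
  exists m => // x Px [xm nxm]; apply: nxm; apply: wo_le_anti => //; exact: mP.
by have [h|h] := wo_le_total x y; [left|right]; split => //; apply: nesym.
Qed.

Lemma wo_ltNle (x y : W) : ~ wo_le x y -> wo_lt y x.
Proof.
move=> nxy; have [//|yx] := wo_le_total x y; split=> // e.
by apply: nxy; rewrite e wo_le_refl.
Qed.

Lemma wo_le_lt_trans (x y z : W) : wo_le x y -> wo_lt y z -> wo_lt x z.
Proof.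
move=> xy [yz nyz]; split; first exact: wo_le_trans yz.
by move=> e; apply: nyz; apply: wo_le_anti => //; rewrite -e.
Qed.

Lemma wo_lt_le_trans (x y z : W) : wo_lt x y -> wo_le y z -> wo_lt x z.
Proof.
move=> [xy nxy] yz; split; first exact: wo_le_trans yz.
by move=> e; apply: nxy; apply: wo_le_anti => //; rewrite e.
Qed.

Lemma wo_le_eqVlt (x y : W) : wo_le x y -> x = y \/ wo_lt x y.
Proof. by move=> xy; have [->|] := pselect (x = y); [left|right; split]. Qed.

Lemma wo_lt_irr (x : W) : ~ wo_lt x x. Proof. by case. Qed.

End WellOrderFacts.

Lemma wellOrder_on (T : Type) : exists W : wellOrder, wo_sort W = T.
Proof.
have [r rP] := well_ordering_principle {classic T}.
by exists (WellOrder rP).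
Qed.

Lemma strict_wo_on (T : Type) : exists lt : T -> T -> Prop, strict_wo lt.
Proof. by have [W <-] := wellOrder_on T; exists (@wo_lt W); exact: wo_lt_strict. Qed.

(** The bound on segments keeps initial segments of [D] small when [D] is
    itself an initial segment. *)
Lemma wellOrder_sub (W : wellOrder) (D : set W) :
  exists2 V : wellOrder, [set: V] #= D & forall v : V,
    exists2 w : W, D w & [set u | wo_lt u v] #<= [set u | wo_lt u w].
Proof.
pose le (x y : {x | D x}) := wo_le (sval x) (sval y).
have leP : well_order le.
  apply: antisymmetric_well_order => [x y /andP[xy yx]|A [x Ax]].
    have := wo_le_anti xy yx; case: x y {xy yx} => x dx [y dy] /= e.
    exact: eq_exist.
  have [|_ [m Am <-] mP] := @wo_minP W (sval @` [set x | x \in A]).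
    by exists (sval x); exists x.
  by exists m; split=> // y Ay; apply: mP; exists y.
exists (WellOrder leP) => [|[v Dv]]; first exact: card_sigT.
exists v => //; apply: (card_le_intro (f := sval)).
  by move=> [x dx] [/= xv nxv]; split=> // e; apply: nxv; exact: eq_exist.
by move=> [x dx] [y dy] /= _ _ e; exact: eq_exist.
Qed.

(** * Arithmetic of cardinals *)

(** If [B] does not embed into [A], then it embeds into no segment of a
    well-order on [A], so that the greedy choice in [B] never stops. *)
Lemma card_le_total (T U : Type) (A : set T) (B : set U) : A #<= B \/ B #<= A.
Proof.
have [BA|nBA] := pselect (B #<= A); [by right|left].
have [lt wo] := strict_wo_on {x | A x}.
apply: (card_le_trans (card_eqR (card_sigT A))).
apply: (greedy_card_le wo) => w Bw; apply: nBA; apply: (card_le_trans Bw).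
apply: (card_le_trans (card_leT _)); exact: card_eqL (card_sigT A).
Qed.

Lemma card_ltW (T U : Type) (A : set T) (B : set U) : ~ (B #<= A) -> A #<= B.
Proof. by have [] := card_le_total A B. Qed.

Lemma card_ltP (K L : Type) : card_lt K L <-> ~ ([set: L] #<= [set: K]).
Proof. by split=> [[]//|nLK]; split=> //; exact: card_ltW. Qed.

Lemma card_lt_le_trans (K L M : Type) :
  card_lt K L -> [set: L] #<= [set: M] -> card_lt K M.
Proof. by move=> /card_ltP KL LM; apply/card_ltP => MK; apply/KL/(card_le_trans LM). Qed.

Lemma card_le_lt_trans (K L M : Type) :
  [set: K] #<= [set: L] -> card_lt L M -> card_lt K M.
Proof. by move=> KL /card_ltP LM; apply/card_ltP => MK; apply/LM/(card_le_trans MK). Qed.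

Lemma infinite_le (T U : Type) (A : set T) (B : set U) :
  A #<= B -> infinite_set A -> infinite_set B.
Proof. by move=> AB /infiniteP nA; apply/infiniteP; exact: card_le_trans AB. Qed.

(** Every cardinal below that of a member [K] of the class is bounded by an
    initial segment of a well-order on [K], and segments have a least one. *)
Lemma least_cardinal_exists (P : Type -> Prop) :
  (exists K, P K) -> exists K, least_cardinal P K.
Proof.
move=> [K PK]; have [lt wo] := strict_wo_on K.
pose Q w := exists2 L, P L & [set: L] #<= [set v | lt v w].
have [|nQ] := pselect (Q !=set0); last first.
  exists K; split=> // L PL; apply: (greedy_card_le wo) => w Lw.
  by apply: nQ; exists w; exists L.
case/(strict_wo_min wo) => w [L PL Lw] wmin; exists L; split=> // L' PL'.
apply: (card_le_trans Lw); apply: (greedy_seg_le wo) => v vw L'v.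
have /wmin : Q v by exists L'.
case=> [e|wv]; apply: (@strict_wo_irr _ _ w wo); first by rewrite -{1}e.
exact: strict_wo_trans wo wv vw.
Qed.

Lemma least_card_set (I T : Type) (F : I -> set T) :
  inhabited I -> exists i, forall j, F i #<= F j.
Proof.
move=> [i0]; have [|K [[i Fi] Kmin]] :=
  @least_cardinal_exists (fun K => exists i, [set: K] #= F i).
  by exists {x | F i0 x}, i0; exact: card_sigT.
exists i => j; apply: (card_le_trans (card_eqR Fi)).
apply: (card_le_trans (Kmin _ _) (card_eqL (card_sigT (F j)))).
by exists j; exact: card_sigT.
Qed.

(** The new point is inserted at the start of a sequence in [K], which moves up
    by one place. *)
Lemma card_option_infinite (K : Type) : infinite_set [set: K] ->
  [set: option K] #<= [set: K].
Proof.
move=> /infiniteP/card_leTE[g gi].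
pose h (o : option K) := if o is Some k then
  (if pselect (exists n, g n = k) is left e then g (sval (cid e)).+1 else k) else g 0.
apply/card_leTE; exists h => -[x|] [y|] //=.
- case: pselect => [ex|nx]; case: pselect => [ey|ny].
  + by move=> /gi[]; case: cid => m /= <-; case: cid => n /= <- ->.
  + by move=> e; case: ny; exists (sval (cid ex)).+1.
  + by move=> e; case: nx; exists (sval (cid ey)).+1.
  + by move=> ->.
- by case: pselect => [ex /gi //|nx e]; case: nx; exists 0.
- by case: pselect => [ex /gi //|nx e]; case: nx; exists 0.
Qed.

Lemma finite_option (K : Type) : finite_set [set: K] -> finite_set [set: option K].
Proof.
move=> Kfin; apply: (@sub_finite_set _ _ (None |` (Some @` [set: K]))).
  by move=> [k|] _; [right; exists k|left].
by rewrite finite_setU; split; [exact: finite_set1|exact: finite_image].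
Qed.

(** Cut a well-order on [K] at the first point whose segment has the
    cardinality of [K]. *)
Lemma initial_ordinal_exists (K : Type) : exists W, initial_ordinal_of K W.
Proof.
have [W <-] := wellOrder_on K.
have [[w Ww]|nW] := pselect (exists w : W, [set: W] #<= [set v | wo_lt v w]); last first.
  by exists W; split=> [|w Ww]; [exact: card_eqxx|apply: nW; exists w].
have [|m Wm mP] := wo_minP (P := [set w : W | [set: W] #<= [set v | wo_lt v w]]).
  by exists w.
have [V VD Vseg] := wellOrder_sub [set v | wo_lt v m].
exists V; split=> [|v Vv].
  apply: card_eqLR; first exact: card_le_trans (card_eqL VD) (card_leT _).
  exact: card_le_trans Wm (card_eqR VD).
have [u um vu] := Vseg v; case: (@wo_lt_irr _ u).
apply: (wo_lt_le_trans um); apply: mP => /=.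
apply: (card_le_trans Wm); apply: (card_le_trans (card_eqR VD)).
exact: card_le_trans Vv vu.
Qed.

(** If no proper segment of [W] could contain [A], the greedy choice would embed
    [W], and hence [K], into [A]. *)
Lemma initial_bounded (K T : Type) (W : wellOrder) (A : set T) :
  initial_ordinal_of K W -> ~ ([set: K] #<= A) ->
  exists w : W, A #<= [set v | wo_lt v w].
Proof.
move=> [WK _] nKA; apply: contrapT => nex; apply: nKA.
apply: (card_le_trans (card_eqR WK)); apply: (greedy_card_le (wo_lt_strict W)) => w Aw.
by apply: nex; exists w.
Qed.

Lemma initial_seg_eq (K T : Type) (W : wellOrder) (A : set T) :
  initial_ordinal_of K W -> ~ ([set: K] #<= A) ->
  exists w : W, [set v | wo_lt v w] #= A.
Proof.
move=> KW nKA; have [w Aw] := initial_bounded KW nKA.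
have [|m Am mP] := wo_minP (P := [set w : W | A #<= [set v | wo_lt v w]]).
  by exists w.
exists m; apply: card_eqLR => //; apply: (greedy_seg_le (wo_lt_strict W)) => v vm Av.
by apply: (@wo_lt_irr _ v); apply: (wo_lt_le_trans vm); exact: mP.
Qed.

Lemma seg_le_option (W : wellOrder) (w : W) :
  [set v | wo_le v w] #<= [set: option {v | wo_lt v w}].
Proof.
apply: (card_le_intro (f := fun v => if pselect (wo_lt v w) is left h
   then Some (exist (fun v => wo_lt v w) v h) else None)) => //.
move=> x y Dx Dy; case: pselect => hx; case: pselect => hy //; first by case.
by move=> _; case: (wo_le_eqVlt Dx) => // ->; case: (wo_le_eqVlt Dy).
Qed.

Lemma initial_seg_le (K : Type) (W : wellOrder) (w : W) :
  initial_ordinal_of K W -> infinite_set [set: K] -> ~ ([set: K] #<= [set v | wo_le v w]).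
Proof.
move=> [WK Winit] Kinf Kw.
have := infinite_le (card_le_trans Kw (seg_le_option w)) Kinf => oinf.
apply: (Winit w); apply: (card_le_trans (card_eqL WK)); apply: (card_le_trans Kw).
apply: (card_le_trans (seg_le_option w)).
apply: (card_le_trans (card_option_infinite _)); last exact: card_eqL (card_sigT _).
by move=> /finite_option.
Qed.

(** Comparing pairs of elements of an initial ordinal by their maximum first,
    the pairs below a given one lie in the square of a smaller set. *)
Lemma card_square_infinite (L : Type) : infinite_set [set: L] ->
  [set: L * L] #<= [set: L].
Proof.
move=> Linf; apply: contrapT => nLL.
have [|K [[Kinf nKK] Kmin]] := @least_cardinal_exists
  (fun K => infinite_set [set: K] /\ ~ ([set: K * K] #<= [set: K])).
  by exists L.
clear L Linf nLL.
have [W KW] := initial_ordinal_exists K; have [WK Winit] := KW.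
pose mx (p : W * W) := if pselect (wo_le p.1 p.2) then p.2 else p.1.
have mx1 p : wo_le p.1 (mx p).
  by rewrite /mx; case: pselect => // h; exact: wo_le_refl.
have mx2 p : wo_le p.2 (mx p).
  rewrite /mx; case: pselect => // h; first exact: wo_le_refl.
  by case: (wo_ltNle h).
have [lt2 wo2] := strict_wo_on (W * W).
have wo := strict_wo_lexi mx (wo_lt_strict W) (fun=> wo2).
have Winf : infinite_set [set: W] by exact: infinite_le (card_eqR WK) Kinf.
apply: nKK; apply: (@card_le_trans _ _ _ [set: W * W]).
  have /card_leTE[f fi] := card_eqR WK.
  apply/card_leTE; exists (fun p => (f p.1, f p.2)) => -[a b] [c d] [].
  by move=> /fi -> /fi ->.
apply: (card_le_trans _ (card_eqL WK)); apply: (greedy_card_le wo) => p Wp.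
pose D := [set v | wo_le v (mx p)].
have {Wp}WD : [set: W] #<= D `*` D.
  apply: (card_le_trans Wp); apply: subset_card_le => q /= qp.
  have {qp} qp : wo_le (mx q) (mx p) by case: qp => [[]//|[-> _]]; exact: wo_le_refl.
  by split; [exact: wo_le_trans (mx1 q) qp|exact: wo_le_trans (mx2 q) qp].
have nWD : ~ ([set: W] #<= D).
  by move=> WD'; apply: (initial_seg_le KW Kinf); exact: card_le_trans (card_eqR WK) WD'.
have Dinf : infinite_set D.
  by move=> Df; apply: Winf; apply: card_le_finite WD _; exact: finite_setX.
have DD : D `*` D #<= D.
  apply: contrapT => nDD.
  have : [set: K] #<= [set: {v | D v}].
    apply: Kmin; split; first exact: infinite_le (card_eqR (card_sigT _)) Dinf.
    move=> h; apply: nDD; apply: (@card_le_trans _ _ _ [set: {v | D v} * {v | D v}]).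
      pose f (q : W * W) := if pselect (D q.1 /\ D q.2) is left h
        then (exist D q.1 h.1, exist D q.2 h.2) else
        (exist D (mx p) (wo_le_refl _), exist D (mx p) (wo_le_refl _)).
      apply: (card_le_intro (f := f)) => // -[a b] [c d] /= ab cd; rewrite /f /=.
      by case: pselect => // h1; case: pselect => // h2 [-> ->].
    exact: card_le_trans h (card_eqL (card_sigT _)).
  move=> KD; apply: nWD; apply: (card_le_trans (card_eqL WK)).
  exact: card_le_trans KD (card_eqL (card_sigT _)).
by apply: nWD; exact: card_le_trans WD DD.
Qed.

Lemma card_le_prod (A B C D : Type) : [set: A] #<= [set: B] ->
  [set: C] #<= [set: D] -> [set: A * C] #<= [set: B * D].
Proof.
move=> /card_leTE[f fi] /card_leTE[g gi]; apply/card_leTE.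
by exists (fun p => (f p.1, g p.2)) => -[a b] [c d] [/fi -> /gi ->].
Qed.

Lemma card_prod_infinite (A B K : Type) : infinite_set [set: K] ->
  [set: A] #<= [set: K] -> [set: B] #<= [set: K] -> [set: A * B] #<= [set: K].
Proof.
move=> Kinf AK BK; exact: card_le_trans (card_le_prod AK BK) (card_square_infinite Kinf).
Qed.

(** A list is determined by its length and the result of folding it with a
    pairing function. *)
Lemma card_seq_infinite (K : Type) : infinite_set [set: K] ->
  [set: seq K] #<= [set: K].
Proof.
move=> Kinf; have /card_leTE[g gi] := card_square_infinite Kinf.
have [k0 _] := infinite_setN0 Kinf.
apply: (@card_le_trans _ _ _ [set: nat * K]); last first.
  by apply: card_prod_infinite => //; apply/infiniteP.
apply/card_leTE; exists (fun s => (size s, foldr (fun a b => g (a, b)) k0 s)).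
elim=> [|a s IH] [|b t] //= [st] /gi[-> e].
by rewrite (IH t) // st e.
Qed.

Lemma card_bigcup_le (I T K : Type) (D : set I) (F : I -> set T) :
  infinite_set [set: K] -> D #<= [set: K] ->
  (forall i, D i -> F i #<= [set: K]) -> \bigcup_(i in D) F i #<= [set: K].
Proof.
move=> Kinf IK FK; have [k0 _] := infinite_setN0 Kinf.
have [f [_ fi]] := card_le_elim IK k0.
have /choice[g gi] i : exists g : T -> K, D i -> forall x y, F i x -> F i y -> g x = g y -> x = y.
  have [Di|nD] := pselect (D i); last by exists (fun=> k0).
  by have [g [_ gi]] := card_le_elim (FK _ Di) k0; exists g.
apply: (card_le_trans _ (card_square_infinite Kinf)).
pose h x := if pselect (exists2 i, D i & F i x) is left e
  then let i := s2val (cid2 e) in (f i, g i x) else (k0, k0).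
apply: (card_le_intro (f := h)) => // x y [i Di Fx] [j Dj Fy]; rewrite /h.
case: pselect => [ex|[]]; last by exists i.
case: pselect => [ey|[]]; last by exists j.
case: (cid2 ex) => i' Di' Fi'; case: (cid2 ey) => j' Dj' Fj' /= [/(fi _ _ Di' Dj') e].
by rewrite -e in Fj' *; apply: gi.
Qed.

(** * The set of cardinals up to a given one *)

(** Cardinals up to [X] are represented by subsets of [X], one for each
    cardinality: the choice depends on the class of [A] under [#=] only. This
    keeps the cardinals up to [X] in a small type. *)
Definition crep (X T : Type) (A : set T) : set X := xget (set0 : set X) (fun S => S #= A).
Arguments crep X [T] A.

Lemma crepE (X T : Type) (A : set T) : A #<= [set: X] -> crep X A #= A.
Proof.
move=> AX; rewrite /crep; apply: (@xgetPex _ (set0 : set X) (fun S => S #= A)).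
have [[x]|nX] := pselect (inhabited X).
  have [f [_ fi]] := card_le_elim AX x; exists (f @` A) => /=.
  by apply: inj_card_eq => a b /set_mem Aa /set_mem Ab; exact: fi.
have A0 : A = set0.
  have X0 : [set: X] = set0 by apply/seteqP; split => // x; case: nX.
  by move: AX; rewrite X0 card_le0 => /eqP.
by exists set0; rewrite A0; exact: card_eq00.
Qed.

Lemma crep_eq (X T U : Type) (A : set T) (B : set U) :
  A #= B -> crep X A = crep X B.
Proof.
move=> AB; rewrite /crep; congr xget; apply/funext => S; apply/propext.
by split=> SA; [exact: card_eq_trans SA AB|apply: card_eq_trans SA _; exact: card_esym].
Qed.

Definition cards (X : Type) : Type := {S : set X | S = crep X S}.

Lemma cards_inj (X : Type) (S T : cards X) : sval S #= sval T -> S = T.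
Proof.
move=> ST; case: S T ST => S SE [T TE] /= ST; apply: eq_exist.
by rewrite SE TE; exact: crep_eq.
Qed.

Lemma crepK (X T : Type) (A : set T) : A #<= [set: X] -> crep X A = crep X (crep X A).
Proof. by move=> AX; apply: crep_eq; apply: card_esym; exact: crepE. Qed.

Definition cardinal_of (X T : Type) (A : set T) : cards X :=
  if pselect (A #<= [set: X]) is left h then exist _ (crep X A) (crepK h)
  else exist _ (crep X (@set0 X)) (crepK (card_ge0 _ _)).

Lemma cardinal_ofE (X T : Type) (A : set T) : A #<= [set: X] ->
  sval (cardinal_of X A) #= A.
Proof. by move=> h; rewrite /cardinal_of; case: pselect => // h'; exact: crepE. Qed.

Lemma cardinal_of_eq (X T U : Type) (A : set T) (B : set U) :
  A #<= [set: X] -> B #<= [set: X] -> A #= B -> cardinal_of X A = cardinal_of X B.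
Proof.
move=> AX BX AB; apply: cards_inj; apply: (card_eq_trans (cardinal_ofE AX)).
by apply: (card_eq_trans AB); apply: card_esym; exact: cardinal_ofE.
Qed.

(** A cardinal below [X] is that of a proper segment of an initial ordinal of
    [X]; the value [None] is left for [X] itself. *)
Lemma card_cards_option (X : Type) : [set: cards X] #<= [set: option X].
Proof.
have [W XW] := initial_ordinal_exists X; have [WX _] := XW.
apply: (@card_le_trans _ _ _ [set: option W]); last first.
  have /card_leTE[f fi] := card_eqL WX.
  by apply/card_leTE; exists (omap f) => -[a|] [b|] //= [/fi ->].
have /choice[f fP] : forall S : cards X, exists o : option W,
    if o is Some w then [set v | wo_lt v w] #= sval S else [set: X] #<= sval S.
  move=> S; have [XS|nXS] := pselect ([set: X] #<= sval S); first by exists None.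
  by have [w] := initial_seg_eq XW nXS; exists (Some w).
apply/card_leTE; exists f => S T e; apply: cards_inj.
have := fP S; have := fP T; rewrite e; case: (f T) => [w wT wS|XT XS].
  exact: card_eq_trans (card_esym wS) wT.
apply: card_eqLR; first exact: card_le_trans (card_leT _) XT.
exact: card_le_trans (card_leT _) XS.
Qed.

Definition icards (X : Type) : Type := {S : cards X | infinite_set (sval S)}.

Lemma icards_inj (X : Type) (S T : icards X) : sval (sval S) #= sval (sval T) -> S = T.
Proof.
move=> /cards_inj; case: S T => S iS [T iT] /= e; exact: eq_exist.
Qed.

Lemma infinite_cardinal_of (X T : Type) (A : set T) : A #<= [set: X] ->
  infinite_set A -> infinite_set (sval (cardinal_of X A)).
Proof. by move=> AX; apply: infinite_le; exact: card_eqR (cardinal_ofE AX). Qed.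

(** The way to bound the number of infinite cardinals up to [X] from below. *)
Lemma icards_intro (X I : Type) (F : I -> Type) :
  (forall i, [set: F i] #<= [set: X]) -> (forall i, infinite_set [set: F i]) ->
  (forall i j, [set: F i] #= [set: F j] -> i = j) -> [set: I] #<= [set: icards X].
Proof.
move=> FX Finf Finj.
pose f i : icards X := exist _ (cardinal_of X [set: F i])
  (infinite_cardinal_of (FX i) (@Finf i)).
apply/card_leTE; exists f => i j e; apply: Finj.
apply: (card_eq_trans (card_esym (cardinal_ofE (FX i)))).
have e' : sval (cardinal_of X [set: F i]) = sval (cardinal_of X [set: F j]).
  exact: (congr1 (fun s => sval (sval s)) e).
by rewrite e'; exact: cardinal_ofE.
Qed.

Lemma icards_mono (X Y : Type) : [set: X] #<= [set: Y] ->
  [set: icards X] #<= [set: icards Y].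
Proof.
move=> XY; apply: (icards_intro (F := fun S : icards X => {x | sval (sval S) x})).
- move=> S; apply: (card_le_trans (card_eqL (card_sigT _))).
  exact: card_le_trans (card_leT _) XY.
- by move=> S; apply: infinite_le (card_eqR (card_sigT _)) _; exact: svalP S.
- move=> S T e; apply: icards_inj; apply: card_eq_trans (card_esym (card_sigT _)) _.
  exact: card_eq_trans e (card_sigT _).
Qed.

Lemma icards_le_cards (X : Type) : [set: icards X] #<= [set: cards X].
Proof.
by apply/card_leTE; exists sval => S T e; apply: icards_inj; rewrite e; exact: card_eqxx.
Qed.

Lemma cards_infinite (X : Type) : infinite_set [set: X] -> infinite_set [set: cards X].
Proof.
move=> Xinf; apply/infiniteP/card_leTE.
have IX n : `I_n #<= [set: X].
  by apply: (card_le_trans (card_leT _)); exact/infiniteP.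
exists (fun n => cardinal_of X `I_n) => m n e; apply/eqP; rewrite -(rwP eqP).
apply/card_eq_II; apply: (card_eq_trans (card_esym (cardinal_ofE (IX m)))).
rewrite e; exact: cardinal_ofE.
Qed.

Lemma card_cards_le (X : Type) : infinite_set [set: X] -> [set: cards X] #<= [set: X].
Proof.
by move=> Xinf; apply: (card_le_trans (card_cards_option X)); exact: card_option_infinite.
Qed.

(** * Transfinite enumeration of cardinals *)

Section NthCardinal.
Variable P : Type -> Prop.

(** Transfinite recursion in the universe of types; a sum over all earlier values
    bounds them, so that an unbounded [P] always provides the next one. *)
Lemma nth_cardinal_exists (W : wellOrder) :
  (forall L, exists2 K, P K & card_lt L K) -> exists K, nth_cardinal P W K.
Proof.
move=> Punb.
have Pbound (I : Type) (G : I -> Type) : exists K, P K /\ forall i, card_lt (G i) K.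
  have [K PK GK] := Punb {i & G i}; exists K; split=> // i.
  apply: card_le_lt_trans GK; apply/card_leTE; exists (fun g => existT G i g).
  by move=> a b e; exact: Eqdep_dec.inj_pair2_eq_dec (fun x y => pselect (x = y)) _ _ _ _ e.
pose least (w : W) (g : forall v, wo_lt v w -> Type) : Type :=
  sval (cid (least_cardinal_exists (Pbound {v | wo_lt v w} (fun v => g (sval v) (svalP v))))).
pose F := Fix (strict_wo_wf (wo_lt_strict W)) (fun _ => Type) least.
have FE w : F w = least w (fun v _ => F v).
  apply: Fix_eq => v g h gh.
  by congr least; do 2 apply: functional_extensionality_dep => ?.
have [K PK] := least_cardinal_exists (Pbound W F).
exists K; exists F; split => // w.
rewrite FE /least; case: cid => L /= [[PL FL] Lmin]; split.
  by split=> // v vw; exact: (FL (exist _ v vw)).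
by move=> M [PM FM]; apply: Lmin; split=> // -[v vw]; exact: FM.
Qed.
End NthCardinal.

(** The property of [F] that is required in [nth_cardinal]. *)
Definition enumerates (P : Type -> Prop) (W : wellOrder) (K : Type) (F : W -> Type) :=
  (forall w, least_cardinal
     (fun L => P L /\ forall v, wo_lt v w -> card_lt (F v) L) (F w)) /\
  least_cardinal (fun L => P L /\ forall v, card_lt (F v) L) K.

Section Enumerates.
Variables (P : Type -> Prop) (W : wellOrder) (K : Type) (F : W -> Type).
Hypothesis PF : enumerates P K F.

Lemma enumerates_P w : P (F w). Proof. by case: (PF.1 w) => -[]. Qed.
Lemma enumerates_top : P K. Proof. by case: (PF.2) => -[]. Qed.

Lemma enumerates_lt v w : wo_lt v w -> card_lt (F v) (F w).
Proof. by move=> vw; case: (PF.1 w) => -[_ /(_ v vw)]. Qed.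

Lemma enumerates_lt_top w : card_lt (F w) K.
Proof. by case: (PF.2) => -[_ /(_ w)]. Qed.

Lemma enumerates_inj v w : [set: F v] #= [set: F w] -> v = w.
Proof.
move=> e; apply: contrapT => /((wo_lt_strict W).2)[] /enumerates_lt[_]; apply.
  exact: card_eqR e.
exact: card_eqL e.
Qed.

Lemma enumerates_le v w : wo_le v w -> [set: F v] #<= [set: F w].
Proof. by move=> /wo_le_eqVlt[->|/enumerates_lt[]//]. Qed.

(** A cardinal [L] with property [P] that is omitted would exceed all [F w], by
    induction and the leastness of [F w], and then [K] by leastness of [K]. *)
Lemma enumerates_cover L : P L ->
  [set: K] #<= [set: L] \/ exists w, [set: L] #= [set: F w].
Proof.
move=> PL; have [|nL] := pselect (exists w, [set: L] #= [set: F w]); [by right|left].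
suff FL w : card_lt (F w) L by apply: PF.2.2; split.
elim/(well_founded_ind (strict_wo_wf (wo_lt_strict W))): w => w IH.
have FwL : [set: F w] #<= [set: L] by apply: (PF.1 w).2; split.
by split=> // LFw; apply: nL; exists w; exact: card_eqLR.
Qed.
End Enumerates.

Definition infinite_type (L : Type) : Prop := infinite_set [set: L].

(** Cantor's diagonal argument. *)
Lemma card_lt_set (L : Type) : card_lt L (set L).
Proof.
apply/card_ltP => /card_leTE[f fi].
pose D := [set x | exists2 S, f S = x & ~ S x].
have DP : D (f D) <-> ~ D (f D).
  by split=> [[S /fi ->]|nD]; last exists D.
have nD : ~ D (f D) by move=> h; have := DP.1 h.
exact: nD (DP.2 nD).
Qed.

Lemma infinite_type_unbounded (L : Type) : exists2 K, infinite_type K & card_lt L K.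
Proof.
exists (set (L + nat)).
  apply/infiniteP/card_leTE; exists (fun n => [set inr n]) => m n e.
  have : [set inr n] (inr m : L + nat) by rewrite -e.
  by case.
apply: card_le_lt_trans (card_lt_set _).
by apply/card_leTE; exists inl => x y [].
Qed.

Lemma is_aleph_exists (W : wellOrder) : exists K, is_aleph W K.
Proof. by apply: nth_cardinal_exists; exact: infinite_type_unbounded. Qed.

Lemma is_aleph_eq (W : wellOrder) (K L : Type) :
  [set: K] #= [set: L] -> is_aleph W K -> is_aleph W L.
Proof.
move=> KL [F [FP [[Kinf FK] Kmin]]]; exists F; split=> //; split.
  split; first exact: infinite_le (card_eqL KL) Kinf.
  by move=> v; apply: card_lt_le_trans (FK v) (card_eqL KL).
by move=> M /Kmin KM; apply: card_le_trans (card_eqR KL) KM.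
Qed.

Lemma sval_set_infinite (X : Type) (S : icards X) :
  infinite_type {x | sval (sval S) x}.
Proof. exact: infinite_le (card_eqR (card_sigT _)) (svalP S). Qed.

Lemma aleph_index_le (W : wellOrder) (K L : Type) (F : W -> Type) :
  enumerates infinite_type K F -> [set: W] #<= [set: icards K].
Proof.
move=> FP; apply: (icards_intro (F := F)); last exact: enumerates_inj FP.
  by move=> w; case: (enumerates_lt_top FP w).
exact: enumerates_P FP.
Qed.

(** Each infinite cardinal up to [F w] is some [F v], and then [v <= w]. *)
Lemma icards_aleph_le (W : wellOrder) (K X : Type) (F : W -> Type) (w : W) :
  enumerates infinite_type K F -> [set: X] #<= [set: F w] ->
  [set: icards X] #<= [set v | wo_le v w].
Proof.
move=> FP XF.
have /choice[f fP] (S : icards X) : exists v, [set: {x | sval (sval S) x}] #= [set: F v].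
  have [KS|//] := enumerates_cover FP (sval_set_infinite (S := S)).
  case: (enumerates_lt_top FP w) => _ []; apply: (card_le_trans KS).
  apply: (card_le_trans (card_eqL (card_sigT _))).
  exact: card_le_trans (card_leT _) XF.
apply: (card_le_intro (f := f)) => [S _|S T _ _ e] /=.
  apply: contrapT => /wo_ltNle /(enumerates_lt FP)/card_ltP; apply.
  apply: (card_le_trans (card_eqR (fP S))); apply: (card_le_trans (card_eqL (card_sigT _))).
  exact: card_le_trans (card_leT _) XF.
apply: icards_inj; apply: (card_eq_trans (card_esym (card_sigT _))).
apply: (card_eq_trans (fP S)); rewrite e; apply: (card_eq_trans (card_esym (fP T))).
exact: card_sigT.
Qed.

(** If [W] is the initial ordinal of [K] and [L] the [W]-th aleph, then always
    [K <= L], since [W] embeds in the infinite cardinals up to [L]. If [K] were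
    less than [L], it would be the [w]-th aleph for some [w] in [W], with fewer
    than [#|K|] infinite cardinals up to it. *)
Lemma aleph_fixed_pointP (K : Type) : aleph_fixed_point K <->
  infinite_set [set: K] /\ [set: K] #<= [set: icards K].
Proof.
split=> [[Kinf [W [WK _] [F FP]]]|[Kinf KiK]]; split=> //.
  exact: card_le_trans (card_eqR WK) (aleph_index_le K FP).
have [W KW] := initial_ordinal_exists K; have [WK _] := KW.
exists W => //; have [L [F FP]] := is_aleph_exists W.
have Linf : infinite_set [set: L] := enumerates_top FP.
apply: (@is_aleph_eq W L); last by exists F.
apply: card_eqLR.
  have [//|[w Kw]] := enumerates_cover FP Kinf.
  case: (initial_seg_le (w := w) KW Kinf); apply: (card_le_trans KiK).
  exact: icards_aleph_le FP (card_eqL Kw).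
apply: (card_le_trans (card_eqR WK)); apply: (card_le_trans (aleph_index_le L FP)).
by apply: (card_le_trans (icards_le_cards L)); exact: card_cards_le.
Qed.

Lemma aleph_fixed_point_eq (K L : Type) : [set: K] #= [set: L] ->
  aleph_fixed_point K -> aleph_fixed_point L.
Proof.
move=> KL /aleph_fixed_pointP[Kinf KiK]; apply/aleph_fixed_pointP; split.
  exact: infinite_le (card_eqL KL) Kinf.
apply: (card_le_trans (card_eqR KL)); apply: (card_le_trans KiK).
exact: icards_mono (card_eqL KL).
Qed.

Lemma uncountable_cofinality_eq (K L : Type) : [set: K] #= [set: L] ->
  uncountable_cofinality K -> uncountable_cofinality L.
Proof.
move=> KL [W [[WK Wi] cof]]; exists W; split=> //; split=> //.
exact: card_eq_trans WK KL.
Qed.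

(** * Cofinality *)

Lemma uncountable_cofinality_intro (K : Type) (W : wellOrder) :
  initial_ordinal_of K W -> (forall S : set W, cofinal S -> ~ countable S) ->
  uncountable_cofinality K.
Proof.
move=> KW Wcof; exists W; split=> //.
have [|L [[S Scof SL] Lmin]] := @least_cardinal_exists
    (fun L => exists2 S : set W, cofinal S & S #= [set: L]).
  exists W, [set: W]; last exact: card_eqxx.
  by move=> w; exists w => //; exact: wo_le_refl.
exists L; last by move=> Lc; apply: (Wcof S) => //; apply: card_le_trans (card_eqL SL) Lc.
split; first by exists S.
move=> S' S'cof; apply: (card_le_trans _ (card_eqL (card_sigT S'))).
by apply: Lmin; exists S' => //; exact: card_esym (card_sigT S').
Qed.

(** Bound each of the cardinals by a segment of the initial ordinal; the
    countably many end points are not cofinal. *)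
Lemma uncountable_cofinality_bounded (L I : Type) (F : I -> Type) :
  uncountable_cofinality L -> countable [set: I] -> (forall i, card_lt (F i) L) ->
  exists2 B, card_lt B L & forall i, [set: F i] #<= [set: B].
Proof.
move=> [W [LW [C [_ Cmin] nC]]] Ic FL.
have [LWe Winit] := LW.
have /choice[f fP] i : exists w : W, [set: F i] #<= [set v | wo_lt v w].
  by apply: (initial_bounded LW); apply/card_ltP.
have ncof : ~ cofinal (range f).
  move=> /Cmin Cf; apply: nC; apply: (card_le_trans Cf).
  by apply: card_le_trans (card_image_le _ _) Ic.
have [w wP] : exists w, forall i, ~ wo_le w (f i).
  apply: contrapT => nw; apply: ncof => w; apply: contrapT => nf; apply: nw.
  by exists w => i wi; apply: nf; exists (f i) => //; exists i.
exists {v | wo_lt v w}.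
  apply/card_ltP => h; apply: (Winit w); apply: (card_le_trans (card_eqL LWe)).
  exact: card_le_trans h (card_eqL (card_sigT _)).
move=> i; apply: (card_le_trans (fP i)); apply: (card_le_trans _ (card_eqR (card_sigT _))).
apply: subset_card_le => v /= vf; apply: wo_lt_le_trans vf _.
by have [] := wo_ltNle (wP i).
Qed.

(** * Fixed points of the aleph function *)

Definition supremum (I : Type) (F : I -> Type) : Type -> Prop :=
  least_cardinal (fun U => forall i, [set: F i] #<= [set: U]).

Lemma supremum_exists (I : Type) (F : I -> Type) : exists U, supremum F U.
Proof.
apply: least_cardinal_exists; exists {i & F i} => i.
apply/card_leTE; exists (fun g => existT F i g) => a b e.
exact: Eqdep_dec.inj_pair2_eq_dec (fun x y => pselect (x = y)) _ _ _ _ e.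
Qed.

(** The number of infinite cardinals up to [U] bounds every [F i], so it is at
    least [U] by leastness. *)
Lemma supremum_fixed_point (I : Type) (F : I -> Type) (U : Type) :
  supremum F U -> infinite_set [set: U] ->
  (forall i, exists j, [set: F i] #<= [set: icards (F j)]) -> aleph_fixed_point U.
Proof.
move=> [FU Umin] Uinf Ficards; apply/aleph_fixed_pointP; split=> //.
apply: Umin => i; have [j FiFj] := Ficards i; apply: (card_le_trans FiFj).
exact: icards_mono.
Qed.

(** From [X] one reaches a larger [Y] with at least [#|X|] infinite cardinals
    up to it, without leaping over a fixed point: a fixed point [L > X] has more
    infinite cardinals up to it than are enumerated in [#|X|] steps. *)
Lemma fixed_point_step (X : Type) : exists Y,
  [/\ infinite_set [set: Y], [set: X] #<= [set: icards Y], card_lt X Y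
    & forall L, aleph_fixed_point L -> card_lt X L -> card_lt Y L].
Proof.
have [W WX] := wellOrder_on X; subst X.
pose P Z := infinite_set [set: Z] /\ card_lt W Z.
have [|Y [F FP]] := @nth_cardinal_exists P W.
  move=> L; have [K Kinf LK] := infinite_type_unbounded (L + W).
  exists K; [split=> //|]; apply: card_le_lt_trans LK; apply/card_leTE;
    by [exists inr => ? ? []|exists inl => ? ? []].
have [Yinf XY] := enumerates_top FP.
exists Y; split => //.
  apply: (icards_intro (F := F)); last exact: enumerates_inj FP.
    by move=> w; case: (enumerates_lt_top FP w).
  by move=> w; case: (enumerates_P FP w).
move=> L /aleph_fixed_pointP[Linf LiL] WL; apply/card_ltP => LY.
have sE (S : icards L) := card_sigT (sval (sval S)).
(* an infinite cardinal up to [L] is at most [W], or enumerated by [F], or [L] *)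
have /choice[f fP] (S : icards L) : exists o : option W + option W,
    match o with
    | inl o => o = sval (cid ((card_leTE _ _).1 (card_cards_option W))) (cardinal_of W (sval (sval S)))
        /\ sval (sval S) #<= [set: W]
    | inr (Some w) => sval (sval S) #= [set: F w]
    | inr None => [set: L] #<= sval (sval S)
    end.
  have [SX|nSX] := pselect (sval (sval S) #<= [set: W]).
    by exists (inl (sval (cid ((card_leTE _ _).1 (card_cards_option W))) (cardinal_of W (sval (sval S))))).
  have PS : P {x | sval (sval S) x}.
    split; first exact: sval_set_infinite.
    by apply/card_ltP => h; apply: nSX; apply: card_le_trans (card_eqR (sE S)) h.
  have [YS|[w Sw]] := enumerates_cover FP PS.
    exists (inr None); apply: (card_le_trans LY); exact: card_le_trans YS (card_eqL (sE S)).
  by exists (inr (Some w)); exact: card_eq_trans (card_esym (sE S)) Sw.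
have LoX : [set: L] #<= [set: option W + option W].
  apply: (card_le_trans LiL); apply/card_leTE; exists f => S T e.
  apply: icards_inj; have := fP S; have := fP T; rewrite e.
  case: (f T) => [_ [-> TX] [E SX]|[w Tw Sw|LT LS]].
  - have := svalP (cid ((card_leTE _ _).1 (card_cards_option W))) _ _ E => E'.
    apply: (card_eq_trans (card_esym (cardinal_ofE SX))); rewrite -E'.
    exact: cardinal_ofE.
  - exact: card_eq_trans Sw (card_esym Tw).
  - apply: card_eqLR; first exact: card_le_trans (card_leT _) LT.
    exact: card_le_trans (card_leT _) LS.
have {LoX} LoX : [set: L] #<= [set: option W * bool].
  apply: (card_le_trans LoX); apply/card_leTE.
  exists (fun s => match s with inl o => (o, true) | inr o => (o, false) end).
  by move=> [x|x] [y|y] [->].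
have [Wfin|Winf] := pselect (finite_set [set: W]).
  apply: Linf; apply: (card_le_finite LoX); rewrite -setXTT; apply: finite_setX => //.
  exact: finite_option.
case: WL => _; apply; apply: (card_le_trans LoX); apply: card_prod_infinite => //.
  exact: card_option_infinite.
apply: (@card_le_trans _ _ _ [set: nat]); last exact/infiniteP.
by apply/card_leTE; exists nat_of_bool => -[] [].
Qed.

(** The supremum of the iterates of [fixed_point_step] is a fixed point. As a
    supremum of countably many cardinals below [L] it stays below an [L] of
    uncountable cofinality. *)
Lemma fixed_point_above (X : Type) : exists U,
  [/\ aleph_fixed_point U, card_lt X U
    & forall L, aleph_fixed_point L -> uncountable_cofinality L ->
        card_lt X L -> card_lt U L].
Proof.
have [step stepP] := choice fixed_point_step.
pose kap n := iter n step X.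
have [U US] := supremum_exists kap; have [kapU Umin] := US.
have [Uinf _ XU1 _] := stepP X.
have XU : card_lt X U by exact: card_lt_le_trans XU1 (kapU 1).
exists U; split => //.
  apply: (supremum_fixed_point US); first exact: infinite_le (kapU 1) Uinf.
  by move=> n; exists n.+1; have [] := stepP (kap n).
move=> L Lfix Lcof XL.
have kapL n : card_lt (kap n) L.
  by elim: n => [//|n IH]; have [_ _ _ /(_ _ Lfix IH)] := stepP (kap n).
have [B BL kapB] := uncountable_cofinality_bounded Lcof (card_lexx _) kapL.
exact: card_le_lt_trans (Umin _ kapB) BL.
Qed.

(** * The first uncountable ordinal *)

(** The initial ordinal of the least uncountable cardinal. *)
Lemma omega1_exists : exists W, is_omega1 W.
Proof.
have [|L [nL Lmin]] := @least_cardinal_exists (fun L => ~ countable [set: L]).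
  exists (set nat) => h; have /card_ltP := card_lt_set nat; exact.
have [W LW] := initial_ordinal_exists L; have [WL Winit] := LW.
exists W; split=> [Wc|w]; first exact/nL/(card_le_trans (card_eqR WL)).
apply: contrapT => nc; apply: (Winit w); apply: (card_le_trans (card_eqL WL)).
apply: (card_le_trans (Lmin {v | wo_lt v w} _) (card_eqL (card_sigT _))) => h.
by apply: nc; exact: card_le_trans (card_eqR (card_sigT _)) h.
Qed.

Lemma countable_bigcup_nat (I T : Type) (D : set I) (F : I -> set T) :
  countable D -> (forall i, D i -> countable (F i)) -> countable (\bigcup_(i in D) F i).
Proof. by move=> Dc Fc; apply: card_bigcup_le => //; exact: infinite_nat. Qed.

Lemma omega1_bounded (W : wellOrder) (I : Type) (D : set I) (f : I -> W) :
  is_omega1 W -> countable D -> exists w, forall i, D i -> wo_lt (f i) w.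
Proof.
move=> [nW segW] Dc; apply: contrapT => nw; apply: nW.
have : countable (\bigcup_(i in D) [set v | wo_le v (f i)]).
  apply: countable_bigcup_nat => // i _; apply: (card_le_trans (seg_le_option _)).
  apply: (card_le_trans _ (card_option_infinite infinite_nat)).
  have := segW (f i) => /(card_le_trans (card_eqL (card_sigT _)))/card_leTE[g gi].
  by apply/card_leTE; exists (omap g) => -[a|] [b|] //= [/gi ->].
apply: card_le_trans; apply: subset_card_le => v _.
apply: contrapT => nv; apply: nw; exists v => i Di; apply: wo_ltNle => vf.
by apply: nv; exists i.
Qed.

(** Let [F] enumerate the first [omega_1] fixed points and let [K] be the next
    one. Since a supremum of fixed points is a fixed point, [K] is the supremum
    of the [F w]; as countable sets are bounded in [omega_1], no countable set is
    cofinal in [K]. Conversely a fixed point [L] of uncountable cofinality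
    exceeds every [F v], by induction on [v]: the countably many earlier ones
    have a bound below [L], and the next fixed point above that bound is still
    below [L]. *)
Lemma omega1st_aleph_fixed_pointP : exists K, omega1st_aleph_fixed_point K /\
  least_cardinal (fun L => aleph_fixed_point L /\ uncountable_cofinality L) K.
Proof.
have [W W1] := omega1_exists.
have [|K KP] := @nth_cardinal_exists aleph_fixed_point W.
  by move=> L; have [U [Ufix LU _]] := fixed_point_above L; exists U.
have [F FP'] := KP; have FP : enumerates aleph_fixed_point K F by [].
exists K; split; first by exists W.
have [W0 W0P] : exists w : W, True.
  have [//|nw] := pselect (exists w : W, True); case: W1 => nW _; case: nW.
  rewrite (_ : [set: W] = set0) ?countable0 //; apply/seteqP; split=> // w _.
  by apply: nw; exists w.
have Finf w : infinite_set [set: F w].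
  by have /aleph_fixed_pointP[] := enumerates_P FP w.
have next (v : W) : exists w : W, wo_lt v w.
  have [w] := omega1_bounded (fun u : W => u) W1 (countable1 v) => wP.
  by exists w; exact: wP.
(* [K] is the supremum of the [F w] *)
have bnd (A : Type) : card_lt A K -> exists v, [set: A] #<= [set: F v].
  move=> AK; apply: contrapT => nA.
  have FA v : [set: F v] #<= [set: A] by apply: card_ltW => h; apply: nA; exists v.
  have [U US] := supremum_exists F; have [FU Umin] := US.
  have Ufix : aleph_fixed_point U.
    apply: (supremum_fixed_point US); first exact: infinite_le (FU W0) (Finf W0).
    by move=> i; exists i; have /aleph_fixed_pointP[] := enumerates_P FP i.
  have KU : [set: K] #<= [set: U].
    apply: FP.2.2; split=> // v; have [w vw] := next v.
    exact: card_lt_le_trans (enumerates_lt FP vw) (FU w).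
  by case: AK => _; apply; apply: card_le_trans KU (Umin _ FA).
have Kinf : infinite_set [set: K].
  by have /aleph_fixed_pointP[] := enumerates_top FP.
split; [split; first exact: enumerates_top FP|move=> L [Lfix Lcof]].
  have [V KV] := initial_ordinal_exists K; have [VK Vinit] := KV.
  apply: (uncountable_cofinality_intro KV) => S Scof Sc.
  have /choice[f fP] (v : V) : exists w : W, [set u | wo_le u v] #<= [set: F w].
    have vK : card_lt {u | wo_le u v} K.
      apply/card_ltP => h; apply: (@initial_seg_le K V v KV Kinf).
      exact: card_le_trans h (card_eqL (card_sigT _)).
    have [w wP] := bnd _ vK; exists w.
    exact: card_le_trans (card_eqR (card_sigT _)) wP.
  have [w wP] := omega1_bounded f W1 Sc.
  have /card_ltP := enumerates_lt_top FP w; apply.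
  apply: (card_le_trans (card_eqR VK)).
  apply: (@card_le_trans _ _ _ (\bigcup_(s in S) [set u | wo_le u s])).
    by apply: subset_card_le => u _; have [s] := Scof u; exists s.
  apply: card_bigcup_le => // [|s Ss].
    by apply: card_le_trans Sc _; exact/infiniteP.
  apply: (card_le_trans (fP s)); apply: (enumerates_le FP).
  by have [] := wP s Ss.
apply: FP.2.2; split=> //.
elim/(well_founded_ind (strict_wo_wf (wo_lt_strict W))) => v IH.
have segc : countable [set: {u | wo_lt u v}].
  exact: card_le_trans (card_eqL (card_sigT _)) (W1.2 v).
have [B BL FB] := uncountable_cofinality_bounded (F := fun u : {u | wo_lt u v} => F (sval u))
  Lcof segc (fun u => IH _ (svalP u)).
have [U [Ufix BU UL]] := fixed_point_above B.
apply: card_le_lt_trans (UL _ Lfix Lcof BL); apply: (FP.1 v).2; split=> // u uv.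
exact: card_le_lt_trans (FB (exist _ u uv)) BU.
Qed.

(** * Counting the cardinals up to a given one *)

(** The cardinals up to the [alpha]-th aleph are the finite ones, the [v]-th
    alephs with [v] in [alpha], and the [alpha]-th aleph itself; they are coded by
    [(a0, n.+2)], [(v, 0)] and [(a0, 1)]. The other inequality holds as the
    infinite set of these cardinals has the cardinality of its square. *)
Lemma cards_aleph (alpha : wellOrder) (X : Type) :
  is_aleph alpha X -> inhabited alpha -> [set: alpha * nat] #= [set: cards X].
Proof.
move=> [F FP'] [a0]; have FP : enumerates infinite_type X F by [].
have Xinf : infinite_set [set: X] := enumerates_top FP.
apply: card_eqLR.
  apply: card_prod_infinite; first exact: cards_infinite.
    exact: card_le_trans (aleph_index_le X FP) (icards_le_cards X).
  exact/infiniteP/cards_infinite.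
have sE (S : cards X) := card_sigT (sval S).
have /choice[f fP] (S : cards X) : exists p : alpha * nat,
    match p.2 with
    | 0 => [set: {x | sval S x}] #= [set: F p.1]
    | 1 => p.1 = a0 /\ [set: X] #<= sval S
    | n.+2 => p.1 = a0 /\ sval S #= `I_n
    end.
  have [[n Sn]|Sinf] := pselect (finite_set (sval S)); first by exists (a0, n.+2).
  have Sinf' : infinite_type {x | sval S x} by exact: infinite_le (card_eqR (sE S)) Sinf.
  have [XS|[w Sw]] := enumerates_cover FP Sinf'; last by exists (w, 0).
  by exists (a0, 1); split=> //; exact: card_le_trans XS (card_eqL (sE S)).
apply/card_leTE; exists f => S T e; apply: cards_inj.
have := fP S; have := fP T; rewrite e; case: (f T) => w [|[|n]] /=.
- move=> Tw Sw; apply: (card_eq_trans (card_esym (sE S))); apply: (card_eq_trans Sw).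
  exact: card_eq_trans (card_esym Tw) (sE T).
- move=> [_ XT] [_ XS]; apply: card_eqLR; first exact: card_le_trans (card_leT _) XT.
  exact: card_le_trans (card_leT _) XS.
- by move=> [_ Tn] [_ Sn]; exact: card_eq_trans Sn (card_esym Tn).
Qed.

(** The cardinals up to [X] are countably many exactly if [X] is the [w]-th aleph
    for some [w] in [omega_1]. *)
Lemma countable_cards_aleph_omega1 (X : Type) : infinite_set [set: X] ->
  countable [set: cards X] <-> lt_aleph_omega1 X.
Proof.
move=> Xinf; split=> [cX|[W [L [W1 [F FP'] XL]]]].
  have [W W1] := omega1_exists; have [L LP] := is_aleph_exists W.
  exists W, L; split=> //; apply/card_ltP => LX; case: W1 => + _; apply.
  have [F FP'] := LP; have FP : enumerates infinite_type L F by [].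
  apply: (card_le_trans (aleph_index_le L FP)); apply: (card_le_trans (icards_mono LX)).
  exact: card_le_trans (icards_le_cards X) cX.
have FP : enumerates infinite_type L F by [].
have [LX|[w Xw]] := enumerates_cover FP Xinf; first by case: XL.
have icX : countable [set: icards X].
  apply: (card_le_trans (icards_aleph_le FP (card_eqL Xw))).
  have [u uP] := omega1_bounded (fun u : W => u) W1 (countable1 w).
  apply: sub_countable (W1.2 u); apply: subset_card_le => v vw.
  by apply: wo_le_lt_trans vw _; exact: uP.
have : [set: cards X] = [set S : cards X | finite_set (sval S)] `|`
    [set S : cards X | infinite_set (sval S)].
  by apply/seteqP; split=> // S _; have [] := pselect (finite_set (sval S)); [left|right].
move=> ->; rewrite -bigcup2E; apply: bigcup_countable => // i _.
case: i => [|[|i]] /=; last exact: countable0.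
  have /choice[f fP] (S : cards X) : exists n, finite_set (sval S) -> sval S #= `I_n.
    by have [[n Sn]|] := pselect (finite_set (sval S)); [exists n|exists 0].
  apply: (card_le_intro (f := f)) => //= S T Sf Tf e; apply: cards_inj.
  by apply: (card_eq_trans (fP _ Sf)); rewrite e; apply: card_esym; exact: fP.
exact: card_le_trans (card_eqR (card_sigT _)) icX.
Qed.

(** The finite cardinals are countably many, so that leaving them out does not
    change the number of cardinals up to [X]. *)
Lemma fixed_point_cards (X : Type) : ~ countable [set: X] ->
  [set: X] #<= [set: cards X] -> aleph_fixed_point X.
Proof.
move=> nX XcX; have Xinf : infinite_set [set: X].
  by move=> /finite_set_countable.
apply/aleph_fixed_pointP; split=> //.
have cnt : [set: cards X] #<= [set: icards X + nat].
  have /choice[f fP] (S : cards X) : exists o : icards X + nat,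
      match o with inl T => sval T = S | inr n => sval S #= `I_n end.
    have [[n Sn]|Si] := pselect (finite_set (sval S)); first by exists (inr n).
    by exists (inl (exist (fun S : cards X => infinite_set (sval S)) S Si)).
  apply/card_leTE; exists f => S T e; have := fP S; have := fP T; rewrite e.
  case: (f T) => [U <- //|n Tn Sn]; apply: cards_inj.
  exact: card_eq_trans Sn (card_esym Tn).
have iinf : infinite_set [set: icards X].
  move=> fi; apply: nX; apply: (card_le_trans XcX); apply: (card_le_trans cnt).
  have /card_leTE[g gi] := finite_set_countable fi.
  apply: (@card_le_trans _ _ _ [set: nat * nat]); last exact: card_eqL card_nat2.
  apply/card_leTE; exists (fun s => match s with inl a => (g a, 0) | inr b => (b, 1) end).
  by move=> [a|a] [b|b] [] // => [[/gi ->]|[->]].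
apply: (card_le_trans XcX); apply: (card_le_trans cnt).
have /infiniteP/card_leTE[g gi] := iinf.
apply: (card_le_trans _ (card_square_infinite iinf)); apply/card_leTE.
exists (fun s => match s with inl a => (a, g 0) | inr b => (g b, g 1) end).
by move=> [a|a] [b|b] [] // => [[->]|[_ /gi]|[_ /gi]|[/gi ->]].
Qed.

Local Open Scope ring_scope.

(** * The cardinality of the continuum *)

Section Continuum.
Variable R : realType.

(** Sets of numbers are embedded into the reals by ternary expansions with digits
    0 and 1. Two sets that differ first at [k] have values that differ by at least
    [3 ^- k / 2], because the tail after [k] is at most half of the term at [k]. *)
Let partial (S : set nat) (n : nat) : R :=
  \sum_(i < n) (if `[<S i>] then 3^-1 ^+ i else 0).

Let partialS S n : partial S n.+1 = partial S n + (if `[<S n>] then 3^-1 ^+ n else 0).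
Proof. by rewrite /partial big_ord_recr. Qed.

Let partial_tail S k m :
  partial S (k + m) + 3 / 2 * 3^-1 ^+ (k + m) <= partial S k + 3 / 2 * 3^-1 ^+ k.
Proof.
elim: m => [|m IH]; first by rewrite addn0.
apply: le_trans IH; rewrite addnS partialS exprS.
have h : 0 < 3^-1 ^+ (k + m) :> R by rewrite exprn_gt0 // invr_gt0.
by case: ifP => _; lra.
Qed.

Let partial_mono S k m : partial S k <= partial S (k + m).
Proof.
elim: m => [|m IH]; first by rewrite addn0.
apply: (le_trans IH); rewrite addnS partialS lerDl.
by case: ifP => // _; rewrite exprn_ge0 // invr_ge0.
Qed.

Let partial_ub S k n : partial S n <= partial S k + 3 / 2 * 3^-1 ^+ k.
Proof.
have h j : 0 <= 3 / 2 * 3^-1 ^+ j :> R.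
  by rewrite mulr_ge0 ?divr_ge0 // exprn_ge0 // invr_ge0.
have [kn|/ltnW nk] := leqP k n.
  rewrite -(subnKC kn); apply: le_trans (partial_tail S k (n - k)).
  by rewrite lerDl.
apply: (@le_trans _ _ (partial S k)); last by rewrite lerDl.
by rewrite -(subnKC nk) partial_mono.
Qed.

Let expansion S : R := sup (range (partial S)).

Let has_sup_expansion S : has_sup (range (partial S)).
Proof.
split; first by exists (partial S 0), 0.
by exists (partial S 0 + 3 / 2 * 3^-1 ^+ 0) => _ [n _ <-]; exact: partial_ub.
Qed.

Let expansion_lt S T k : (forall i, (i < k)%N -> S i <-> T i) -> S k -> ~ T k ->
  expansion T < expansion S.
Proof.
move=> ST Sk Tk; have e : partial S k = partial T k.
  apply: eq_bigr => i _; congr (if _ then _ else _).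
  by apply/asbool_equiv_eq/ST.
have h : 0 < 3^-1 ^+ k :> R by rewrite exprn_gt0 // invr_gt0.
have lo : partial S k.+1 <= expansion S.
  by apply: ub_le_sup; [case: (has_sup_expansion S)|exists k.+1].
have hi : expansion T <= partial T k.+1 + 3 / 2 * 3^-1 ^+ k.+1.
  by apply: ge_sup; [exists (partial T 0), 0|move=> _ [n _ <-]; exact: partial_ub].
move: lo hi; rewrite !partialS (asboolT Sk) (asboolF Tk) exprS e; lra.
Qed.

Lemma card_set_nat_le_real : [set: set nat] #<= [set: R].
Proof.
apply/card_leTE; exists expansion => S T e; apply: contrapT => nST.
have [k kP kmin] : exists2 k, ~ (S k <-> T k) & forall i, (i < k)%N -> S i <-> T i.
  have exk : exists k, `[< ~ (S k <-> T k) >].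
    apply: contrapT => nk; apply: nST; apply/seteqP.
    by split => i Hi; apply: contrapT => nHi; apply: nk; exists i; apply/asboolP; tauto.
  case: (ex_minnP exk) => k /asboolP kP kmin; exists k => // i ik.
  by apply: contrapT => /asboolT/kmin; rewrite leqNgt ik.
have [Sk|nSk] := pselect (S k).
  have := @expansion_lt S T k kmin Sk; rewrite e ltxx => h.
  have /h : ~ T k by tauto.
  by [].
have := @expansion_lt T S k (fun i ik => iff_sym (kmin i ik)); rewrite e ltxx => h.
have Tk : T k by apply: contrapT; tauto.
by have := h Tk nSk.
Qed.

(** A real is determined by the rationals below it. *)
Lemma card_real_le_set_nat : [set: R] #<= [set: set nat].
Proof.
apply/card_leTE.
exists (fun x n => exists2 q : rat, pickle q = n & ratr q < x) => x y e.
apply: contrapT => /eqP; rewrite neq_lt => /orP[] /rat_in_itvoo[q];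
  rewrite in_itv /= => /andP[lq qr].
- suff [q' /(pcan_inj pickleK) -> /(lt_trans lq)] : exists2 q' : rat, pickle q' = pickle q & ratr q' < x.
    by rewrite ltxx.
  by move/(congr1 (@^~ (pickle q))): e => /= ->; exists q.
- suff [q' /(pcan_inj pickleK) -> /(lt_trans lq)] : exists2 q' : rat, pickle q' = pickle q & ratr q' < y.
    by rewrite ltxx.
  by move/(congr1 (@^~ (pickle q))): e => /= <-; exists q.
Qed.

Lemma real_uncountable : ~ countable [set: R].
Proof.
move=> cR; have /card_ltP := card_lt_set nat; apply.
exact: card_le_trans card_set_nat_le_real cR.
Qed.

Lemma real_infinite : infinite_set [set: R].
Proof. by move=> /finite_set_countable; exact: real_uncountable. Qed.

Lemma card_real_power_nat : [set: nat -> R] #<= [set: R].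
Proof.
have /card_leTE[f fi] := card_real_le_set_nat.
apply: (card_le_trans _ card_set_nat_le_real); apply/card_leTE.
exists (fun g n => exists2 p : nat * nat, pickle p = n & f (g p.1) p.2) => g h e.
apply/funext => i; apply: fi; apply/funext => j; apply/propext.
have eij : (exists2 p : nat * nat, pickle p = pickle (i, j) & f (g p.1) p.2) =
  (exists2 p : nat * nat, pickle p = pickle (i, j) & f (h p.1) p.2).
  exact: (congr1 (@^~ (pickle (i, j))) e).
split=> fgij.
  have : exists2 p : nat * nat, pickle p = pickle (i, j) & f (g p.1) p.2 by exists (i, j).
  by rewrite eij => -[p /(pcan_inj pickleK) ->].
have : exists2 p : nat * nat, pickle p = pickle (i, j) & f (h p.1) p.2 by exists (i, j).
by rewrite -eij => -[p /(pcan_inj pickleK) ->].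
Qed.

(** The theorem of König: if [A n] were smaller than the set of reals, then the
    [n]-th terms of the sequences listed by [A n] would omit some real [y n], and
    the sequence [y] would be listed by no [A n]. *)
Lemma real_bigcup_full (A : nat -> set R) :
  \bigcup_n A n = setT -> exists n, [set: R] #<= A n.
Proof.
move=> AT; apply: contrapT => nA.
have /card_leTE[c ci] := card_real_power_nat.
have cK : forall g, exists x, c g = x by move=> g; exists (c g).
pose d x : nat -> R := if pselect (exists g, c g = x) is left h then sval (cid h) else fun=> 0.
have dc g : d (c g) = g.
  by rewrite /d; case: pselect => [h|[]]; [apply: ci; case: cid|exists g].
have /choice[y yP] n : exists y, forall x, A n x -> d x n <> y.
  apply: contrapT => ny; apply: nA; exists n.
  apply: (card_surj (f := fun x => d x n)) => y _; apply: contrapT => nx.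
  by apply: ny; exists y => x Ax e; apply: nx; exists x.
have : (\bigcup_n A n) (c y) by rewrite AT.
by move=> [n _ /yP]; rewrite dc.
Qed.

(** The segments of an initial ordinal of the reals are smaller than the set of
    reals, so countably many of them do not cover it. *)
Lemma real_uncountable_cofinality : uncountable_cofinality R.
Proof.
have [W RW] := initial_ordinal_exists R; have [WR Winit] := RW.
apply: (uncountable_cofinality_intro RW) => S Scof Sc.
have /card_leTE[f fi] := card_eqR WR.
have [g [_ gi]] := card_le_elim Sc 0%N.
have [|n Rn] := @real_bigcup_full (fun n x => exists2 s, S s /\ g s = n & wo_le (f x) s).
  by apply/seteqP; split=> // x _; have [s Ss xs] := Scof (f x); exists (g s) => //; exists s.
have [_ [s [Ss sn] _]] := infinite_setN0 (infinite_le Rn real_infinite).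
apply: (@initial_seg_le R W s RW real_infinite); apply: (card_le_trans Rn).
apply: (card_le_intro (f := f)) => [x [t [St tn]]|x y _ _]; last exact: fi.
by rewrite (gi t s St Ss) // tn.
Qed.

End Continuum.

Local Close Scope ring_scope.

Local Open Scope ring_scope.

(** * The space omega + 1 *)

Lemma compact_nat_finite (C : set nat) : compact C -> finite_set C.
Proof.
rewrite compact_cover => /(_ nat C (fun n => [set n])) [].
- by move=> n _; apply: discrete_open.
- by move=> n Cn; exists n.
move=> D _ CD; apply: sub_finite_set (finite_fset D).
by move=> n /CD[m mD ->].
Qed.

Lemma omega_plus_one_openP (U : set omega_plus_one) :
  open U <-> (U None -> finite_set [set n | ~ U (Some n)]).
Proof.
rewrite openE; split=> [oU /oU [C [/compact_nat_finite Cfin _] CU]|UN].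
  apply: sub_finite_set Cfin => n /= nU; apply: contrapT => nC; apply: nU.
  by apply: CU; left; exists n.
move=> [n|] Un.
  by apply/(@principal_filterP nat).
exists [set n | ~ U (Some n)].
  by split; [apply: finite_compact; exact: UN|exact: discrete_closed].
by move=> _ [[n /= /contrapT Un' <-]|->].
Qed.

Lemma omega_plus_one_closedP (K : set omega_plus_one) :
  closed K <-> K None \/ finite_set [set n | K (Some n)].
Proof.
rewrite -openC omega_plus_one_openP /setC /=.
have -> : [set n | ~ ~ K (Some n)] = [set n | K (Some n)].
  by apply/seteqP; split=> n /= h; [exact: contrapT|].
by split=> [h|[KN|//] //]; have [|] := pselect (K None); [left|right; exact: h].
Qed.

(** Closedness in the image of the embedding [e] is closedness of the preimage,
    and the closed sets of omega + 1 are known. *)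
Lemma not_closed_in_embedding (X : topologicalType) (e : omega_plus_one -> X) (S : set X) :
  embedding e -> not_closed_in S (range e) <->
  ~ S (e None) /\ infinite_set [set n | S (e (Some n))].
Proof.
move=> [ei eP]; rewrite /not_closed_in.
suff -> : closed (S `&` range e : set (subspace (range e))) <-> closed (e @^-1` S).
  by rewrite omega_plus_one_closedP; tauto.
rewrite closed_subspaceP; split; [move=> [V cV VS]|].
  rewrite -openC; apply/eP; exists (~` V); first exact: closed_openC.
  apply/seteqP; split=> x /= nS => [Vx|Sx]; apply: nS.
    have : (V `&` range e) (e x) by split=> //; exists x.
    rewrite VS => -[[Sx _] _]; exact: Sx.
  have : (S `&` range e `&` range e) (e x) by split; [split=> //|]; exists x.
  by rewrite -VS => -[].
rewrite -openC => /eP[V oV VS]; exists (~` V); first exact: open_closedC.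
apply/seteqP; split=> [y [nVy [x _ xy]]|y [[Sy [x _ xy]] _]]; subst y.
  do ?split; try by exists x.
  by apply: contrapT => nS; apply: nVy; have : (~` (e @^-1` S)) x by []; rewrite VS.
split; last by exists x.
by move=> Vx; have : (e @^-1` V) x by []; rewrite -VS; apply.
Qed.

(** * Sequences in metric spaces *)

Section Levels.
Variables (R : realType) (X : Type) (d : X -> X -> R).
Hypothesis dm : is_metric d.

(** Points of equal level form an annulus around [x], and high levels are near
    [x]; by the convention [0^-1 = 0] the centre [x] has level 0. *)
Definition level (x y : X) : nat := Num.truncn (d x y)^-1.

(** A nontrivial sequence that converges to [x] is the set of its terms: an
    infinite set of which only finitely many elements lie in each annulus. *)
Definition converging (x : X) (A : set X) : Prop :=
  [/\ infinite_set A, ~ A x & forall n, finite_set [set y | A y /\ (level x y <= n)%N]].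

Definition accumulation (x : X) : Prop := exists A, converging x A.

Lemma metric_gt0 x y : x <> y -> 0 < d x y.
Proof.
case: dm => d0 dE _ _ xy; rewrite lt_neqAle d0 andbT eq_sym.
by apply/eqP => /dE.
Qed.

Lemma metric_refl x : d x x = 0.
Proof. by case: dm => _ dE _ _; apply/dE. Qed.

Lemma level_refl x : level x x = 0%N.
Proof. by rewrite /level metric_refl // invr0 truncn0. Qed.

Lemma level_leP x y n : x <> y -> (level x y <= n)%N = (n.+1%:R^-1 < d x y).
Proof.
move=> /metric_gt0 d0; rewrite -ltnS /level truncn_lt_nat ?invr_ge0 ?ltW //.
by rewrite -[RHS]ltf_pV2 ?invrK // posrE ?invr_gt0.
Qed.

Lemma level_geP x y n : x <> y -> (n < level x y)%N = (d x y <= n.+1%:R^-1).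
Proof. by move=> xy; rewrite ltnNge level_leP // -leNgt. Qed.

End Levels.

Local Close Scope ring_scope.

Local Open Scope ring_scope.

Section Converging.
Variables (R : realType) (X : Type) (d : X -> X -> R).
Hypothesis dm : is_metric d.

Lemma converging_finite_far x A (r : R) : converging d x A -> 0 < r ->
  finite_set [set y | A y /\ r <= d x y].
Proof.
move=> [_ nAx Afin] r0; apply: sub_finite_set (Afin (Num.truncn r^-1)) => y [Ay ry].
split=> //; rewrite /level le_truncn // lef_pV2 // posrE //.
exact: lt_le_trans ry.
Qed.

Lemma convergingP x A : infinite_set A -> ~ A x ->
  (forall r : R, 0 < r -> finite_set [set y | A y /\ r <= d x y]) -> converging d x A.
Proof.
move=> Ainf nAx Afin; split=> // n.
have n0 : 0 < (n.+1%:R^-1 : R) by rewrite invr_gt0.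
apply: sub_finite_set (Afin _ n0) => y [Ay ly]; split=> //.
by move: ly; rewrite level_leP // => [/ltW//|xy]; apply: nAx; rewrite xy.
Qed.

Lemma converging_exists x (S : set X) :
  (forall n, exists y, [/\ S y, x <> y & (n <= level d x y)%N]) ->
  exists2 A, A `<=` S & converging d x A.
Proof.
move=> /choice[u uP]; exists (range u); first by move=> _ [n _ <-]; case: (uP n).
have Afin n : finite_set [set y | range u y /\ (level d x y <= n)%N].
  apply: sub_finite_set (finite_image u (finite_II n.+1)) => _ [[m _ <-] lm] /=.
  by exists m => //=; have [_ _ ml] := uP m; rewrite ltnS (leq_trans ml).
split=> // [fin|[n _ nx]]; last by have [_ + _] := uP n; rewrite nx.
have /finite_set_leP[N _] := fin.
have [M MP] : exists M, forall y, range u y -> (level d x y <= M)%N.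
  have : finite_set (level d x @` range u) by exact: finite_image.
  move=> /finite_seqP[s sE]; exists (\max_(i <- s) i)%N => y uy.
  have ys : level d x y \in s.
    have ly : (level d x @` range u) (level d x y) by exists y.
    by rewrite sE in ly.
  exact: (@leq_bigmax_seq _ s xpredT id).
have [_ _] := uP M.+1; rewrite leqNgt ltnS; apply/negP.
by rewrite negbK; apply: MP; exists M.+1.
Qed.

Lemma accumulation_exists x : (forall n, exists2 y, x <> y & (n <= level d x y)%N) ->
  accumulation d x.
Proof.
move=> h; have [|A _ Ax] := @converging_exists x setT; last by exists A.
by move=> n; have [y] := h n; exists y.
Qed.

Lemma converging_unique x y A B : converging d x A -> converging d y B ->
  infinite_set (A `&` B) -> x = y.
Proof.
move=> cA cB AB; apply: contrapT => xy; have xy0 := metric_gt0 dm xy.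
have r0 : 0 < d x y / 2 by rewrite divr_gt0.
apply: AB; have := converging_finite_far cA r0; have := converging_finite_far cB r0.
move=> fB fA; apply: (@sub_finite_set _ _
    ([set z | A z /\ d x y / 2 <= d x z] `|` [set z | B z /\ d x y / 2 <= d y z])).
  move=> z [Az Bz]; have [xz|xz] := lerP (d x y / 2) (d x z); [by left|right; split=> //].
  case: dm => _ _ ds dt; have := dt x z y; rewrite (ds z y); lra.
by rewrite finite_setU.
Qed.

Lemma converging_union x A B : converging d x A -> converging d x B ->
  converging d x (A `|` B).
Proof.
move=> [Ai nA Af] [Bi nB Bf]; split; first by rewrite finite_setU => -[].
  by case.
move=> n; apply: (@sub_finite_set _ _ ([set y | A y /\ (level d x y <= n)%N] `|`
   [set y | B y /\ (level d x y <= n)%N])); last by rewrite finite_setU.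
by move=> y [[Ay|By] yn]; [left|right].
Qed.

Lemma converging_countable x A : converging d x A -> countable A.
Proof.
move=> [_ _ Af].
apply: (@sub_countable _ _ _ (\bigcup_n [set y | A y /\ (level d x y <= n)%N])).
  by apply: subset_card_le => y Ay; exists (level d x y).
by apply: bigcup_countable => // n _; apply: finite_set_countable.
Qed.

Lemma finite_set_far (F : set X) y : finite_set F -> ~ F y ->
  exists2 r : R, 0 < r & forall z, F z -> r <= d y z.
Proof.
move=> Ffin nF.
have : finite_set (d y @` F) by exact: finite_image.
move=> /finite_seqP[t tE].
have tpos r : r \in t -> 0 < r.
  move=> rt; have : [set` t] r by []; rewrite -tE => -[z Fz <-].
  by apply: metric_gt0 => // yz; apply: nF; rewrite yz.
exists (\big[Num.min/1]_(r <- t) r).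
  by rewrite big_seq; elim/big_ind: _ => // a b a0 b0; rewrite lt_min a0.
move=> z Fz; have : (d y @` F) (d y z) by exists z.
rewrite tE /=; elim: t {tE tpos} => // a t IH; rewrite in_cons big_cons ge_min.
by move=> /orP[/eqP->|/IH->]; rewrite ?lexx ?orbT.
Qed.

(** In this form of seq(X) challenges and answers are of the same kind, and the
    relation splits into local ones, for the different limits [x]. *)
Definition sequence_rel : tukey_rel :=
  let S := {p : X * set X | converging d p.1 p.2} in
  @TukeyRel S S (fun p q => (sval p).1 = (sval q).1 /\
    infinite_set ((sval p).2 `&` (sval q).2)).

End Converging.

Section SeqRel.
Variables (R : realType) (X : topologicalType) (d : X -> X -> R).
Hypothesis dm : is_metric d.
Hypothesis dtop : forall U : set X, open U <->
  forall x, U x -> exists2 r : R, 0 < r & forall y, d x y < r -> U y.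

Let ball_open x (r : R) : open [set y | d x y < r].
Proof.
apply/dtop => y xy; exists (r - d x y) => [|z yz /=]; first by rewrite subr_gt0.
by case: dm => _ _ _ dt; have := dt x y z; move: yz; lra.
Qed.

Lemma embedding_converging (e : omega_plus_one -> X) : embedding e ->
  converging d (e None) (range (fun n => e (Some n))).
Proof.
move=> [ei eP]; apply: convergingP => //.
- move=> fin; apply: infinite_nat.
  apply: (@card_le_finite _ _ _ (range (fun n => e (Some n)))) => //.
  apply: (card_le_intro (f := fun n => e (Some n))) => [n _|m n _ _ /ei []//].
  by exists n.
- by move=> [n _ /ei].
- move=> r r0; have : open (e @^-1` [set y | d (e None) y < r]).
    by apply/eP; exists [set y | d (e None) y < r]; first exact: ball_open.
  rewrite omega_plus_one_openP /= metric_refl // => /(_ r0) fin.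
  apply: sub_finite_set (finite_image (fun n => e (Some n)) fin).
  by move=> _ [[n _ <-] rn]; exists n => //=; apply/negP; rewrite -leNgt.
Qed.

(** Number the terms of the countable set [A]. An open set [U] of omega + 1 is the
    preimage of the complement of the image of its complement, and this image is
    closed: a point [y] outside of it has positive distance to [x], unless the
    image is finite, and near [y] there are only finitely many terms. *)
Lemma converging_embedding x A : converging d x A -> exists e : omega_plus_one -> X,
  [/\ embedding e, e None = x & range (fun n => e (Some n)) = A].
Proof.
move=> cA; have [Ainf nAx _] := cA.
have /card_eqTE[u [ui us]] : [set: nat] #= [set: {y | A y}].
  apply: (card_eq_trans _ (card_esym (card_sigT A))); apply: card_eqLR.
    exact/infiniteP.
  exact: converging_countable cA.
pose e (o : omega_plus_one) := if o is Some n then sval (u n) else x.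
have eA n : A (e (Some n)) by exact: svalP.
have ex n : e (Some n) <> x by move=> h; apply: nAx; rewrite -h; exact: eA.
have ei : injective e.
  move=> [m|] [n|] //; last by move=> h; case: (ex n).
    move=> h; congr Some; apply: ui; move: h; rewrite /e; case: (u m) (u n) => a pa [b pb] /= h.
    exact: eq_exist.
  by move/ex.
exists e; split=> //; last first.
  apply/seteqP; split=> [_ [n _ <-]//|y Ay].
  by have [n un] := us (exist _ y Ay); exists n => //; rewrite /e un.
split=> // U; split=> [|[V oV ->]].
  rewrite omega_plus_one_openP => UP.
  exists (~` (e @` ~` U)); last first.
    apply/seteqP; split=> o /=; first by move=> Uo [o' nU /ei oo]; apply: nU; rewrite oo.
    by move=> h; apply: contrapT => nU; apply: h; exists o.
  apply/dtop => y yK; have [UN|nUN] := pselect (U None).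
    have Kfin : finite_set (e @` ~` U).
      apply: finite_image; apply: sub_finite_set (finite_image Some (UP UN)).
      by move=> [n|] //= nU; exists n.
    have [r r0 rP] := finite_set_far dm Kfin yK; exists r => // z yz Kz.
    by have := rP _ Kz; rewrite leNgt yz.
  have xy : x <> y by move=> xy; apply: yK; exists None.
  have r0 : 0 < d x y / 2 by rewrite divr_gt0 // metric_gt0.
  have fin := converging_finite_far cA r0.
  have [|r1 r10 r1P] := @finite_set_far _ _ d dm
     ([set z | A z /\ d x y / 2 <= d x z] `&` (e @` ~` U)) y (finite_setIl _ fin).
    by case.
  exists (Num.min r1 (d x y / 2)); first by rewrite lt_min r10.
  move=> z; rewrite lt_min => /andP[zr1 zr0] Kz.
  have [dxz|dxz] := lerP (d x y / 2) (d x z); last first.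
    by case: dm => _ _ ds dt; have := dt x z y; rewrite (ds z y); lra.
  case: (Kz) => -[n|] nUn ez; last by move: dxz; rewrite -ez metric_refl // leNgt r0.
  have := r1P z; rewrite leNgt zr1 => h.
  by have : false by apply: h; split=> //; split=> //; rewrite -ez; exact: eA.
rewrite omega_plus_one_openP /= => /((dtop V).1 oV)[r r0 rV].
have fin := converging_finite_far cA r0.
apply: card_le_finite fin; apply: (card_le_intro (f := fun n => e (Some n))).
  move=> n nV; split; first exact: eA.
  by rewrite leNgt; apply/negP => /rV.
by move=> m n _ _ /ei[].
Qed.

Lemma not_closed_limit (S : set X) : ~ closed S ->
  exists2 x, ~ S x & exists2 A, A `<=` S & converging d x A.
Proof.
move=> nS; apply: contrapT => nx; apply: nS; rewrite -openC; apply/dtop => x nSx.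
apply: contrapT => nr; apply: nx; exists x => //; apply: converging_exists => n.
apply: contrapT => ny; apply: nr; exists n.+1%:R^-1; first by rewrite invr_gt0.
move=> y xy Sy; apply: ny; exists y.
have nxy : x <> y by move=> e; apply: nSx; rewrite e.
split=> //; apply: ltnW; rewrite level_geP //; exact: ltW.
Qed.

Lemma converging_not_closed x A : converging d x A -> ~ closed A.
Proof.
move=> cA; have [Ai nA _] := cA; rewrite -openC => /(dtop _).1 /(_ x nA)[r r0 rA].
apply: Ai; apply: sub_finite_set (converging_finite_far cA r0) => y Ay.
by split=> //; rewrite leNgt; apply/negP => /rA.
Qed.

(** A convergent sequence without its limit is a non-closed set. *)
Lemma seq_rel_ge_sequence_rel : tukey_ge (seq_rel X) (sequence_rel d).
Proof.
have /choice[e eP] (T : CSplus X) : exists e : omega_plus_one -> X,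
    embedding e /\ sval T = range e.
  by have [e ee eT] := svalP T; exists e.
exists (fun p => exist _ (sval p).2 (converging_not_closed (svalP p))).
exists (fun T => exist (fun p => converging d p.1 p.2)
   (e T None, range (fun n => e T (Some n))) (embedding_converging (eP T).1)).
move=> [[x A] /= cA] T; have [eT ->] := eP T.
rewrite not_closed_in_embedding // => -[nA Ainf].
have AT : infinite_set (A `&` range (fun n => e T (Some n))).
  move=> fin; apply: Ainf; apply: card_le_finite fin.
  apply: (card_le_intro (f := fun n => e T (Some n))) => [n An|m n _ _ /eT.1[]//].
  by split=> //; exists n.
by split; [exact (converging_unique dm cA (embedding_converging eT) AT)|].
Qed.

(** A non-closed set contains a sequence converging to a point outside of it. *)
Lemma sequence_rel_ge_seq_rel : tukey_ge (sequence_rel d) (seq_rel X).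
Proof.
have /choice[psi psiP] (S : NC X) : exists p : neg (sequence_rel d),
    ~ sval S (sval p).1 /\ (sval p).2 `<=` sval S.
  have [x nSx [A AS cA]] := not_closed_limit (svalP S).
  by exists (exist _ (x, A) cA).
have /choice[e eP] (p : pos (sequence_rel d)) : exists e : omega_plus_one -> X,
  [/\ embedding e, e None = (sval p).1 & range (fun n => e (Some n)) = (sval p).2].
  by case: p => -[x A] cA; exact: converging_embedding cA.
exists psi; pose cs p : CSplus X := exist _ (range (e p))
  (ex_intro2 _ _ (e p) (let: And3 h _ _ := eP p in h) erefl).
exists cs => S p /= [pS Sp]; have [ep eN er] := eP p; have [nS sS] := psiP S.
rewrite not_closed_in_embedding // eN -pS; split=> // fin; apply: Sp.
apply: sub_finite_set (finite_image (fun n => e p (Some n)) fin) => y [/sS Sy].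
by rewrite -er => -[n _ ny]; exists n => //=; rewrite ny.
Qed.

Lemma seq_rel_eq_sequence_rel : tukey_eq (seq_rel X) (sequence_rel d).
Proof. by split; [exact: seq_rel_ge_sequence_rel|exact: sequence_rel_ge_seq_rel]. Qed.

End SeqRel.

Local Close Scope ring_scope.

(** * Comparing sequences in two spaces *)

Lemma tukey_ge_trans (A B C : tukey_rel) : tukey_ge A B -> tukey_ge B C -> tukey_ge A C.
Proof.
move=> [f [g fg]] [f' [g' fg']]; exists (f \o f'), (g' \o g) => c a h.
by apply: fg'; apply: fg.
Qed.

Lemma tukey_eq_sym (A B : tukey_rel) : tukey_eq A B -> tukey_eq B A.
Proof. by case. Qed.

Lemma tukey_eq_trans (A B C : tukey_rel) : tukey_eq A B -> tukey_eq B C -> tukey_eq A C.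
Proof.
by move=> [ab ba] [bc cb]; split; [exact: tukey_ge_trans bc|exact: tukey_ge_trans ba].
Qed.

Lemma tukey_type_eq (A B : tukey_rel) : tukey_eq A B -> tukey_type A = tukey_type B.
Proof.
move=> AB; apply/funext => C; apply/propext; split=> [AC|BC].
  exact: tukey_eq_trans (tukey_eq_sym AB) AC.
exact: tukey_eq_trans AB BC.
Qed.

Lemma tukey_type_inj (A B : tukey_rel) : tukey_type A = tukey_type B -> tukey_eq A B.
Proof.
move=> AB; rewrite -/(tukey_type A B) AB /tukey_type.
by split; exists id, id.
Qed.

Section Compare.
Variables (R : realType) (X Y : Type) (d : X -> X -> R) (d' : Y -> Y -> R).

(** Two challenges at the same point are met by one answer, the union of the
    two sequences; challenges at distinct points are not. *)
Lemma accumulation_card_le : tukey_ge (sequence_rel d) (sequence_rel d') ->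
  accumulation d' #<= accumulation d.
Proof.
move=> [psi [phi pp]].
apply: (card_le_trans (card_eqR (card_sigT (accumulation d')))).
have /choice[c cP] (y : {y | accumulation d' y}) : exists c : neg (sequence_rel d'),
    (sval c).1 = sval y.
  by have [A cA] := svalP y; exists (exist _ (sval y, A) cA).
apply: (card_le_intro (f := fun y => (sval (psi (c y))).1)).
  by move=> y _; exists (sval (psi (c y))).2; exact: (svalP (psi (c y))).
move=> y z _ _ e.
have cU : converging d (sval (psi (c y))).1
    ((sval (psi (c y))).2 `|` (sval (psi (c z))).2).
  apply: converging_union; first exact: (svalP (psi (c y))).
  by rewrite e; exact: (svalP (psi (c z))).
pose u : pos (sequence_rel d) := exist (fun p => converging d p.1 p.2) (_, _) cU.
have [yu _] : holds (c y) (phi u).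
  apply: pp; split=> //=; have [yinf _ _] := svalP (psi (c y)).
  by apply: (sub_infinite_set _ yinf) => t ct; split=> //; left.
have [zu _] : holds (c z) (phi u).
  apply: pp; split=> //=; have [zinf _ _] := svalP (psi (c z)).
  by apply: (sub_infinite_set _ zinf) => t ct; split=> //; right.
have : sval y = sval z by rewrite -!cP yu zu.
case: y z {e cU u yu zu} => y py [z pz] /= e; exact: eq_exist.
Qed.

(** The last two conditions say that infinite subsets of the punctured
    neighbourhood on which [j] is considered converge to [x] iff their images
    converge to [y]. *)
Definition local_le (x : X) (y : Y) : Prop := exists m (j : X -> Y),
  [/\ forall z, (m < level d x z)%N -> (0 < level d' y (j z))%N,
      forall z z', (m < level d x z)%N -> (m < level d x z')%N -> j z = j z' -> z = z',
      forall n, exists n', forall z, (m < level d x z)%N ->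
        (level d' y (j z) <= n)%N -> (level d x z <= n')%N &
      forall n, exists n', forall z, (m < level d x z)%N ->
        (level d x z <= n)%N -> (level d' y (j z) <= n')%N].

Hypothesis dm' : is_metric d'.

Hypothesis dm : is_metric d.

(** Challenges are transported by taking images under [j], answers by taking
    preimages. A fixed sequence [A0] is added to the preimage, which might be
    finite. *)
Lemma local_le_transfer x y : accumulation d x -> local_le x y ->
  exists (f : set X -> set Y) (g : set Y -> set X),
  [/\ forall A, converging d x A -> converging d' y (f A),
      forall B, converging d' y B -> converging d x (g B) &
      forall A B, converging d x A -> infinite_set (f A `&` B) -> infinite_set (A `&` g B)].
Proof.
move=> [A0 cA0] [m [j [jy jinj j1 j2]]].
pose far := [set z | (m < level d x z)%N].
exists (fun A => j @` (A `&` far)), (fun B => A0 `|` (far `&` j @^-1` B)).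
have farinf A : converging d x A -> infinite_set (A `&` far).
  move=> [Ainf _ Afin] fin; apply: Ainf.
  apply: (@sub_finite_set _ _ ((A `&` far) `|` [set z | A z /\ (level d x z <= m)%N])).
    by move=> z Az; rewrite /far /=; have [|] := leqP (level d x z) m; [right|left].
  by rewrite finite_setU.
split=> [A cA|B [Binf nB Bfin]|A B cA].
- have [Ainf nA Afin] := cA; split.
  + move=> fin; apply: (farinf _ cA); apply: (card_le_finite _ fin).
    apply: (card_le_intro (f := j)) => [z zA|z z' [_ zf] [_ zf']]; first by exists z.
    exact: jinj.
  + by move=> [z [_ /jy +] jz]; rewrite jz level_refl.
  + move=> n; have [n' nn'] := j1 n.
    apply: sub_finite_set (finite_image j (Afin n')) => _ [[z [Az zf] <-] jzn].
    by exists z => //; split=> //; exact: nn'.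
- have [A0inf nA0 A0fin] := cA0; split.
  + by apply: (sub_infinite_set _ A0inf); exact: subsetUl.
  + by move=> [//|[+ _]]; rewrite /far /= level_refl.
  + move=> n; apply: (@sub_finite_set _ _ ([set z | A0 z /\ (level d x z <= n)%N] `|`
        [set z | (far z /\ B (j z)) /\ (level d x z <= n)%N])).
      by move=> z [[A0z|Bz] zn]; [left|right].
    rewrite finite_setU; split=> //; have [n' nn'] := j2 n.
    apply: (card_le_finite _ (Bfin n')); apply: (card_le_intro (f := j)).
      by move=> z [[zf Bz] zn]; split=> //; exact: nn'.
    by move=> z z' [[zf _] _] [[zf' _] _]; exact: jinj.
- move=> inf fin; apply: inf.
  apply: sub_finite_set (finite_image j fin) => _ [[z [Az zf] <-] Bz].
  by exists z => //; split=> //; right.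
Qed.

(** The last hypothesis provides an answer for the points outside the range of
    [i], where no challenge has to be met. *)
Lemma tukey_ge_sequence_rel (i : X -> Y) :
  (forall x, accumulation d x -> accumulation d' (i x) /\ local_le x (i x)) ->
  (forall x x', accumulation d x -> accumulation d x' -> i x = i x' -> x = x') ->
  (accumulation d' !=set0 -> accumulation d !=set0) ->
  tukey_ge (sequence_rel d') (sequence_rel d).
Proof.
move=> iP iinj ne.
have /choice[fg fgP] x : exists fg : (set X -> set Y) * (set Y -> set X),
  accumulation d x ->
  [/\ forall A, converging d x A -> converging d' (i x) (fg.1 A),
      forall B, converging d' (i x) B -> converging d x (fg.2 B) &
      forall A B, converging d x A -> infinite_set (fg.1 A `&` B) ->
        infinite_set (A `&` fg.2 B)].
  have [accx|] := pselect (accumulation d x); last by exists (fun=> set0, fun=> set0).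
  have [_ lx] := iP _ accx; have [f [g fg]] := local_le_transfer accx lx.
  by exists (f, g).
have accp (p : neg (sequence_rel d)) : accumulation d (sval p).1.
  by exists (sval p).2; exact: (svalP p).
have psic (p : neg (sequence_rel d)) :
    converging d' (i (sval p).1) ((fg (sval p).1).1 (sval p).2).
  by have [+ _ _] := fgP _ (accp p); apply; exact: (svalP p).
pose psi (p : neg (sequence_rel d)) : neg (sequence_rel d') :=
  exist (fun q => converging d' q.1 q.2) (_, _) (psic p).
have /choice[phi phiP] (q : pos (sequence_rel d')) : exists p : pos (sequence_rel d),
    forall x, accumulation d x -> i x = (sval q).1 -> sval p = (x, (fg x).2 (sval q).2).
  have [[x [accx ix]]|nx] :=
    pselect (exists x, accumulation d x /\ i x = (sval q).1).
    have cx : converging d x ((fg x).2 (sval q).2).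
      by have [_ + _] := fgP _ accx; apply; rewrite ix; exact: (svalP q).
    exists (exist _ (x, _) cx) => x' accx' ix' /=.
    by rewrite (iinj x' x) // ix' ix.
  have [|x [A cA]] := ne; first by exists (sval q).1, (sval q).2; exact: (svalP q).
  by exists (exist _ (x, A) cA) => x' accx' ix'; case: nx; exists x'.
exists psi, phi => p q [pq inf].
have e := phiP q _ (accp p) pq; split; first by rewrite e.
by rewrite e /=; have [_ _] := fgP _ (accp p); apply=> //; exact: (svalP p).
Qed.

(** If each annulus near [x] fits into every late enough union of annuli
    around [y], the annuli of [x] can be placed one after another into disjoint
    blocks of annuli of [y]. *)
Lemma blocks_local_le x y m : (forall n N, (m < n)%N -> exists N',
    [set z | level d x z = n] #<= [set w | (N < level d' y w <= N')%N]) ->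
  local_le x y.
Proof.
move=> blk.
have /choice[next nextP] (nN : nat * nat) : exists N', (m < nN.1)%N ->
    [set z | level d x z = nN.1] #<= [set w | (nN.2 < level d' y w <= N')%N].
  have [mn|] := boolP (m < nN.1)%N; last by exists 0.
  by have [N' N'P] := blk nN.1 nN.2 mn; exists N'.
(* block [k] consists of the levels above [N k] and up to [N k.+1] *)
pose fix N k := if k is k'.+1 then maxn (next (m + k, N k')) (N k').+1 else 0.
have Nlt k l : (k < l)%N -> (N k < N l)%N.
  elim: l => // l IH; rewrite ltnS leq_eqVlt => /orP[/eqP->|/IH kl] /=.
    by rewrite leq_maxr.
  by apply: (ltn_trans kl); rewrite leq_maxr.
have Nle k l : (k <= l)%N -> (N k <= N l)%N.
  by rewrite leq_eqVlt => /orP[/eqP->//|/Nlt/ltnW].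
have kN k : (k <= N k)%N.
  by elim: k => // k IH; apply: leq_ltn_trans IH (Nlt _ _ (ltnSn k)).
have /choice[g gP] k : exists g : X -> Y,
    (forall z, level d x z = (m + k.+1)%N -> (N k < level d' y (g z) <= N k.+1)%N) /\
    (forall z z', level d x z = (m + k.+1)%N -> level d x z' = (m + k.+1)%N ->
      g z = g z' -> z = z').
  have mk : (m < (m + k.+1, N k).1)%N by rewrite /= addnS ltnS leq_addr.
  have [g [g1 g2]] := card_le_elim (nextP _ mk) y.
  exists g; split=> // z /g1 /= /andP[-> h] /=.
  by rewrite (leq_trans h) // leq_maxl.
pose k z := (level d x z - m.+1)%N.
have kE z : (m < level d x z)%N -> level d x z = (m + (k z).+1)%N.
  by move=> mz; rewrite /k -addSnnS subnKC.
exists m, (fun z => g (k z) z); split.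
- by move=> z /kE/((gP (k z)).1 z)/andP[+ _]; apply: leq_ltn_trans.
- move=> z z' mz mz' e; have /andP[z1 z2] := (gP _).1 _ (kE _ mz).
  have /andP[z1' z2'] := (gP _).1 _ (kE _ mz'); rewrite -e in z1' z2'.
  have kk : k z = k z'.
    have [h|h|//] := ltngtP (k z) (k z').
      by have := leq_ltn_trans (leq_trans z2 (Nle _ _ h)) z1'; rewrite ltnn.
    by have := leq_ltn_trans (leq_trans z2' (Nle _ _ h)) z1; rewrite ltnn.
  apply: ((gP (k z)).2 z z'); first exact: kE; last by rewrite e kk.
  by rewrite kk; exact: kE.
- move=> n; exists (n + m.+1)%N => z mz jz.
  have /andP[z1 _] := (gP _).1 _ (kE _ mz).
  have := ltnW (leq_ltn_trans (kN _) (leq_trans z1 jz)).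
  by rewrite /k leq_subLR addnC.
- move=> n; exists (N n.+1) => z mz zn; have /andP[_ z2] := (gP _).1 _ (kE _ mz).
  by apply: (leq_trans z2); apply: Nle; rewrite ltnS (leq_trans (leq_subr _ _)).
Qed.
End Compare.

(** * Local cardinalities *)

Section LocalSize.
Variables (R : realType) (X : Type) (d : X -> X -> R).

Definition tail (x : X) (n : nat) : set X := [set z | (n < level d x z)%N].
Definition annulus (x : X) (n : nat) : set X := [set z | level d x z = n].

Let stable x : exists n, forall m, tail x n #<= tail x m := least_card_set (tail x) (inhabits 0).

(** By the choice of the radius, no punctured neighbourhood of [x] has a smaller
    cardinality. *)
Definition small_nbhd (x : X) : set X := tail x (sval (cid (stable x))).

(** Two points whose neighbourhoods have the same least cardinality may still
    differ: if its cofinality is countable, it can be attained by single annuli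
    or only approached by them. *)
Definition thick (x : X) : Prop :=
  forall n, exists2 m, (n < m)%N & small_nbhd x #<= annulus x m.

Lemma small_nbhd_le x n : small_nbhd x #<= tail x n.
Proof. by rewrite /small_nbhd; case: cid. Qed.

Lemma annulus_le_small x : exists m, forall n, (m < n)%N -> annulus x n #<= small_nbhd x.
Proof.
exists (sval (cid (stable x))) => n mn; apply: subset_card_le => z.
by rewrite /annulus /small_nbhd /tail /= => ->.
Qed.

Lemma accumulation_tail_infinite x n : accumulation d x -> infinite_set (tail x n).
Proof.
move=> [A [Ainf _ Afin]] fin; apply: Ainf.
apply: (@sub_finite_set _ _ (tail x n `|` [set z | A z /\ (level d x z <= n)%N])).
  by move=> z Az; rewrite /tail /=; have [|] := leqP (level d x z) n; [right|left].
by rewrite finite_setU.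
Qed.
End LocalSize.

Section LocalCompare.
Variables (R : realType) (X Y : Type) (d : X -> X -> R) (d' : Y -> Y -> R).

(** A set smaller than every neighbourhood of [y] embeds into some block of
    annuli near [y]: if [S] is infinite, a neighbourhood would otherwise be a
    countable union of blocks smaller than [S]. *)
Lemma embed_block (T : Type) (S : set T) (y : Y) (N : nat) : accumulation d' y ->
  ~ (small_nbhd d' y #<= S) ->
  exists N', S #<= [set w | (N < level d' y w <= N')%N].
Proof.
move=> accy Sy; have tinf := accumulation_tail_infinite (n := N) accy.
have [Sfin|Sinf] := pselect (finite_set S).
  have Stail : S #<= tail d' y N.
    by apply: (card_le_trans (finite_set_countable Sfin)); exact/infiniteP.
  have [f [f1 f2]] := card_le_elim Stail y.
  have /finite_seqP[s sE] : finite_set ((level d' y \o f) @` S) by exact: finite_image.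
  exists (\max_(i <- s) i)%N; apply: (card_le_intro (f := f)) => // z Sz.
  rewrite /= (f1 _ Sz) /=.
  have zs : level d' y (f z) \in s.
    have h : ((level d' y \o f) @` S) (level d' y (f z)) by exists z.
    by rewrite sE in h.
  exact: (@leq_bigmax_seq _ s xpredT id).
apply: contrapT => nN; apply: Sy; apply: (card_le_trans (small_nbhd_le d' y N)).
apply: (@card_le_trans _ _ _ (\bigcup_N' [set w | (N < level d' y w <= N')%N])).
  apply: subset_card_le => w Nw; exists (level d' y w) => //=.
  by rewrite leqnn andbT; exact: Nw.
apply: (card_le_trans _ (card_eqL (card_sigT S))); apply: card_bigcup_le.
- exact: infinite_le (card_eqR (card_sigT S)) Sinf.
- by apply/infiniteP; exact: infinite_le (card_eqR (card_sigT S)) Sinf.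
- move=> N' _; apply: (card_le_trans _ (card_eqR (card_sigT S))).
  by apply: card_ltW => h; apply: nN; exists N'.
Qed.

(** If [y] is thick, single annuli around [y] suffice. Otherwise every annulus
    near [x] is smaller than all neighbourhoods of [y]. *)
Lemma local_le_small (x : X) (y : Y) : accumulation d' y ->
  ~ (small_nbhd d' y #<= small_nbhd d x) \/
  (small_nbhd d x #<= small_nbhd d' y /\ (thick d x -> thick d' y)) ->
  local_le d d' x y.
Proof.
move=> accy xy; have [m0 m0P] := annulus_le_small d x.
have xley : small_nbhd d x #<= small_nbhd d' y by case: xy => [/card_ltW|[]].
have [ty|nty] := pselect (thick d' y).
  apply: (@blocks_local_le _ _ _ _ _ x y m0) => n N mn; have [N' NN' yN'] := ty N.
  exists N'; apply: (card_le_trans (m0P _ mn)); apply: (card_le_trans xley).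
  apply: (card_le_trans yN'); apply: subset_card_le => w /= ->.
  by rewrite NN' leqnn.
have [m mP] : exists m, forall n, (m < n)%N -> ~ (small_nbhd d' y #<= annulus d x n).
  case: xy => [yx|[_ tt]].
    by exists m0 => n mn yn; apply: yx; apply: card_le_trans yn (m0P _ mn).
  apply: contrapT => nm; apply: nty; apply: tt => n; apply: contrapT => nn; apply: nm.
  exists n => k nk yk; apply: nn; exists k => //; exact: card_le_trans xley yk.
apply: (@blocks_local_le _ _ _ _ _ x y m) => n N mn.
exact: embed_block accy (mP _ mn).
Qed.
End LocalCompare.

(** * Injections that respect a well-ordered valuation *)

Lemma finite_card_sub_eq (T : Type) (A B : set T) (w : T) :
  finite_set B -> A `<=` B -> B w -> ~ A w -> ~ (B #<= A).
Proof.
move=> Bfin AB Bw nAw BA.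
have ABw : A `<=` B `\ w by move=> x Ax; split; [exact: AB|move=> xw; rewrite xw in Ax].
have [n nB] : exists n, B `\ w #= `I_n by exact: finite_setD.
have Bn : B #= `I_n.+1 by apply/eq_cardSP; exists w.
have : `I_n.+1 #<= `I_n.
  apply: (card_le_trans (card_eqR Bn)); apply: (card_le_trans BA).
  exact: card_le_trans (subset_card_le ABw) (card_eqL nB).
by rewrite card_le_II ltnn.
Qed.

Lemma infinite_le_setU (T U : Type) (A : set T) (B C : set U) :
  infinite_set A -> A #<= B `|` C -> A #<= B \/ A #<= C.
Proof.
move=> Ainf ABC.
wlog CB : B C ABC / C #<= B.
  move=> h; have [CB|BC] := card_le_total C B; first exact: h.
  by rewrite setUC in ABC; have [] := h _ _ ABC BC; [right|left].
left; have Binf : infinite_set B.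
  move=> Bfin; apply: Ainf; apply: (card_le_finite ABC); rewrite finite_setU; split=> //.
  exact: card_le_finite CB Bfin.
apply: (card_le_trans ABC); rewrite -bigcup2E.
apply: (card_le_trans _ (card_eqL (card_sigT B))).
have Binf' := infinite_le (card_eqR (card_sigT B)) Binf.
apply: card_bigcup_le => //; first exact/infiniteP.
move=> i _; apply: (card_le_trans _ (card_eqR (card_sigT B))).
by case: i => [|[|i]].
Qed.

(** An initial ordinal of [C], extended to all of [W]. *)
Lemma strict_wo_initial_on (W : Type) (C : set W) : exists2 lt : W -> W -> Prop,
  strict_wo lt & forall w, C w -> ~ (C #<= [set v | C v /\ lt v w]).
Proof.
have [lt wo] := strict_wo_on W.
have [[w0 Cw0]|nC] := pselect (C !=set0); last first.
  by exists lt => // w Cw; case: nC; exists w.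
have [V [VC Vinit]] := initial_ordinal_exists {w | C w}.
have CV : C #<= [set: V] := card_le_trans (card_eqR (card_sigT C)) (card_eqR VC).
have [g _] := (card_eqTE _ _).1 (card_esym VC).
have [p [_ pinj]] := card_le_elim CV (g (exist _ w0 Cw0)).
exists (fun x y => wo_lt (p x) (p y) \/ (p x = p y /\ lt x y)).
  exact: (strict_wo_lexi p (wo_lt_strict V) (fun=> wo)).
move=> w Cw Cle; apply: (Vinit (p w)); apply: (card_le_trans (card_eqL VC)).
apply: (card_le_trans (card_eqL (card_sigT C))); apply: (card_le_trans Cle).
apply: (card_le_intro (f := p)) => [v [Cv []//]|u v [Cu _] [Cv _]]; last exact: pinj.
move=> [/(pinj _ _ Cv Cw) vw]; rewrite vw => ww.
by case: (strict_wo_irr wo ww).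
Qed.

Lemma strict_wo_cards (X : Type) :
  strict_wo (fun S T : cards X => ~ (sval T #<= sval S)).
Proof.
split=> [P [S PS]|S T ST].
  have [[m Pm] mP] := least_card_set (fun S : {S | P S} => sval (sval S))
    (inhabits (exist _ S PS)).
  by exists m => // T PT; apply; exact: mP (exist _ T PT).
apply: contrapT => /not_orP[/contrapT TS /contrapT ST']; apply: ST.
by apply: cards_inj; exact: card_eqLR.
Qed.

(** A transfinite form of Hall's marriage theorem. The sets of candidates
    [y] with [t y >= s x] are nested, and the points [x] with the fewest
    candidates are served first, each class of points with equally many
    candidates in the order of an initial ordinal. When [w] is served, the points
    with at most as many candidates as [w] are, by hypothesis, no more than the
    candidates of [w]; so those already served are fewer: for finitely many
    candidates since [w] is left out, and for infinitely many since the points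
    with fewer candidates and the proper segment of the class of [w] both are. *)
Lemma nested_hall (X Y T : Type) (lt : T -> T -> Prop) (P : set X) (Q : set Y)
    (s : X -> T) (t : Y -> T) : strict_wo lt ->
  (forall u, [set x | P x /\ ~ lt (s x) u] #<= [set y | Q y /\ ~ lt (t y) u]) ->
  Y -> exists i : X -> Y,
    (forall x, P x -> Q (i x) /\ ~ lt (t (i x)) (s x)) /\
    (forall x x', P x -> P x' -> i x = i x' -> x = x').
Proof.
move=> wo PQ y0.
pose W := {x | P x}; pose cand (w : W) := [set y | Q y /\ ~ lt (t y) (s (sval w))].
pose c (w : W) : cards Y := cardinal_of Y (cand w).
have cE w : sval (c w) #= cand w by exact: cardinal_ofE (card_leT _).
have /choice[lt2 lt2P] (S : cards Y) : exists lt2 : W -> W -> Prop, strict_wo lt2 /\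
    forall w, c w = S -> ~ ([set v | c v = S] #<= [set v | c v = S /\ lt2 v w]).
  by have [l2 wo2 h] := strict_wo_initial_on [set v : W | c v = S]; exists l2.
pose before (v w : W) := ~ (sval (c w) #<= sval (c v)) \/ (c v = c w /\ lt2 (c w) v w).
have wob : strict_wo before.
  exact: (strict_wo_lexi c (strict_wo_cards Y) (fun S => (lt2P S).1)).
(* the lowest value on [B] has the most candidates, and [B] is bounded by their
   number *)
have lowest (B : set W) : B !=set0 ->
    (exists2 v, B v & forall u, B u -> ~ lt (s (sval u)) (s (sval v))) .
  move=> [v Bv]; have [|_ [m Bm <-] mP] := wo.1 ((s \o sval) @` B).
    by exists (s (sval v)); exists v.
  by exists m => // u Bu; apply: mP; exists u.
have bound (B : set W) (v : W) : (forall u, B u -> ~ lt (s (sval u)) (s (sval v))) ->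
    B #<= cand v.
  move=> Bv; apply: (card_le_trans _ (PQ (s (sval v)))).
  apply: (card_le_intro (f := sval)) => [u /Bv Bu|[a pa] [b pb] _ _ /= e].
    by split=> //; exact: svalP.
  exact: eq_exist.
have avail w : ~ (cand w #<= [set v | before v w]).
  pose B1 := [set v | ~ (sval (c w) #<= sval (c v))].
  pose B2 := [set v | c v = c w /\ lt2 (c w) v w].
  pose C := [set v | c v = c w].
  rewrite (_ : [set v | before v w] = B1 `|` B2) // => le.
  have irr : ~ lt2 (c w) w w := strict_wo_irr (lt2P (c w)).1.
  have B1C : B1 `|` C #<= cand w.
    have [|v Bv vP] := lowest (B1 `|` C); first by exists w; right.
    apply: (card_le_trans (bound _ _ vP)).
    case: Bv => [/card_ltW vw|cvw]; last first.
      by apply: (card_le_trans (card_eqR (cE v))); rewrite cvw; exact: card_eqL (cE w).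
    apply: (card_le_trans (card_eqR (cE v))); exact: card_le_trans vw (card_eqL (cE w)).
  have [fin|inf] := pselect (finite_set (cand w)).
    apply: (@finite_card_sub_eq _ (B1 `|` B2) (B1 `|` C) w).
    - exact: card_le_finite B1C fin.
    - by move=> v [|[]]; [left|right].
    - by right.
    - move=> [|[_ //]]; apply; exact: card_lexx.
    - exact: card_le_trans B1C le.
  have [wB1|wB2] := infinite_le_setU inf le.
    have [|v Bv vP] := lowest B1; first exact: infinite_setN0 (infinite_le wB1 inf).
    apply: Bv; apply: (card_le_trans (card_eqL (cE w))); apply: (card_le_trans wB1).
    exact: card_le_trans (bound _ _ vP) (card_eqR (cE v)).
  apply: ((lt2P (c w)).2 w erefl); apply: (card_le_trans _ wB2).
  by apply: card_le_trans B1C; apply: subset_card_le => v; right.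
have [f [fc fi]] := greedy_injection wob avail.
exists (fun x => if pselect (P x) is left h then f (exist _ x h) else y0).
split=> [x Px|x x' Px Px']; case: pselect => // h; first exact: fc (exist _ x h).
by case: pselect => // h' /fi[].
Qed.

Local Open Scope ring_scope.

(** * Metric spaces *)

Definition metrizes (R : realType) (X : topologicalType) (d : X -> X -> R) : Prop :=
  is_metric d /\ forall U : set X, open U <->
    forall x, U x -> exists2 r : R, 0 < r & forall y, d x y < r -> U y.

(** A point is determined by its rational distances to a countable dense set. *)
Lemma separable_card_le (R : realType) (X : topologicalType) (d : X -> X -> R) :
  metrizes d -> separable X -> [set: X] #<= [set: R].
Proof.
move=> [dm dtop] [D Dc Dd]; apply: (card_le_trans _ (card_set_nat_le_real R)).
have [g [_ gi]] := card_le_elim Dc 0%N.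
have [_ _ ds dt] := dm.
pose f x : set nat := fun n => exists (y : X) (q : rat),
  [/\ D y, d x y < ratr q & pickle (g y, q) = n].
apply/card_leTE; exists f => x x' e; apply: contrapT => xx'.
have r0 : 0 < d x x' / 2 by rewrite divr_gt0 // metric_gt0.
have [||y [xy Dy]] := Dd [set y | d x y < d x x' / 2].
- by exists x; rewrite /= metric_refl.
- apply/dtop => y /= xy; exists (d x x' / 2 - d x y) => [|z yz]; first by rewrite subr_gt0.
  by have := dt x y z; move: yz; lra.
have [q] := rat_in_itvoo xy; rewrite in_itv /= => /andP[yq qr].
have : f x (pickle (g y, q)) by exists y, q.
rewrite e => -[y' [q' [Dy' yq' /(pcan_inj pickleK)[gy qq]]]].
rewrite (gi _ _ Dy' Dy gy) qq in yq'.
by have := dt x y x'; rewrite (ds y x'); move: yq' yq qr; lra.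
Qed.

Section MetricTopology.
Variables (R : realType) (X : Type) (d : X -> X -> R) (dm : is_metric d).

(** The name depends on the proof that [d] is a metric, so that it can carry the
    topology of [d]. *)
Definition metric_space : Type := let _ := dm in X.

Definition metric_open (U : set metric_space) : Prop :=
  forall x, U x -> exists2 r : R, 0 < r & forall y, d x y < r -> U y.

Let openT : metric_open setT. Proof. by move=> x _; exists 1. Qed.

Let openI : setI_closed metric_open.
Proof.
move=> U V oU oV x [Ux Vx]; have [r r0 rU] := oU x Ux; have [s s0 sV] := oV x Vx.
exists (Num.min r s) => [|y]; first by rewrite lt_min r0.
by rewrite lt_min => /andP[yr ys]; split; [exact: rU|exact: sV].
Qed.

Let open_bigU (I : Type) (f : I -> set metric_space) :
  (forall i, metric_open (f i)) -> metric_open (\bigcup_i f i).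
Proof.
move=> fo x [i _ fx]; have [r r0 rf] := fo i x fx.
by exists r => // y xy; exists i => //; exact: rf.
Qed.

HB.instance Definition _ := gen_eqMixin metric_space.
HB.instance Definition _ := gen_choiceMixin metric_space.
HB.instance Definition _ := isOpenTopological.Build metric_space openT openI open_bigU.

Lemma metric_space_metrizes : @metrizes R metric_space d.
Proof. by split. Qed.

End MetricTopology.

(** * A space with prescribed accumulation points *)

Section Grid.
Variables (R : realType) (S : set R).

Let h (n : nat) : R := 2^-1 ^+ n.

Let h_gt0 n : 0 < h n. Proof. by rewrite exprn_gt0 // invr_gt0. Qed.

Let h_half n m : (n < m)%N -> h m <= h n / 2.
Proof.
move=> nm; rewrite mulrC -exprS /h; apply: ler_wiXn2l => //; first by rewrite invr_ge0.
by rewrite invf_le1 // ler1n.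
Qed.

(** The points [(k / 2^n, 1 / 2^n)] are isolated and accumulate at the whole
    horizontal axis, of which only [S] is kept. *)
Let on_grid (p : R * R) (u : int * nat) : Prop := p = (u.1%:~R * h u.2, h u.2).

Definition grid_points : Type :=
  {p : R * R | (S p.1 /\ p.2 = 0) \/ exists u, on_grid p u}.

Definition grid_dist (p q : grid_points) : R :=
  `|(sval p).1 - (sval q).1| + `|(sval p).2 - (sval q).2|.

Lemma grid_dist_metric : is_metric grid_dist.
Proof.
split=> [x y|x y|x y|x y z].
- by rewrite addr_ge0.
- split=> [/eqP|->]; last by rewrite /grid_dist !subrr !normr0 addr0.
  rewrite paddr_eq0 // !normr_eq0 !subr_eq0 => /andP[/eqP e1 /eqP e2].
  case: x y e1 e2 => -[a b] px [[a' b'] py] /= aa bb.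
  by apply: eq_exist; rewrite aa bb.
- by rewrite /grid_dist !(distrC (sval x).1) !(distrC (sval x).2).
- by rewrite /grid_dist addrACA lerD // ler_distD.
Qed.

Definition grid_space : topologicalType := metric_space grid_dist_metric.

Let gpt (u : int * nat) : grid_points := exist _ _ (or_intror (ex_intro _ u erefl)).

Let grid_near (p : grid_points) : (sval p).2 = 0 -> forall n, exists2 u,
  grid_dist p (gpt u) <= h n & gpt u <> p.
Proof.
case: p => -[s b] sp /= b0 n; subst b.
pose k := Num.floor (s / h n.+1).
exists (k, n.+1); last first.
  by move=> [_ /eqP]; rewrite gt_eqF.
have /andP[k1 k2] : k%:~R <= s / h n.+1 < (k + 1)%:~R by exact: floor_itv.
have hn : h n = h n.+1 + h n.+1 by rewrite /h exprS; lra.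
rewrite /grid_dist /= sub0r normrN (gtr0_norm (h_gt0 _)) hn lerD2r.
rewrite ler_norml; move: k1 k2; rewrite intrD ler_pdivlMr // ltr_pdivrMr // mulrDl mul1r => k1 k2.
by apply/andP; split; lra.
Qed.

Let h_small (r : R) : 0 < r -> exists n, h n < r.
Proof.
move=> r0; exists (Num.truncn r^-1).+1.
rewrite /h exprVn -[X in _ < X]invrK ltf_pV2 ?posrE ?exprn_gt0 ?invr_gt0 //.
have r1 : r^-1 < (Num.truncn r^-1).+1%:R by rewrite real_truncnS_gt // num_real.
apply: (lt_trans r1); rewrite -natrX ltr_nat; exact: ltn_expl.
Qed.

Lemma grid_space_separable : separable grid_space.
Proof.
exists (range gpt).
  apply: (card_le_trans (card_image_le gpt setT)).
  exact: countableP.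
move=> O [p Op] oO; have [[sp1 sp2]|[u pu]] := svalP p.
  have [r r0 rO] := ((metric_space_metrizes grid_dist_metric).2 O).1 oO p Op.
  have [n nr] := h_small r0; have [u pu _] := grid_near sp2 n.
  by exists (gpt u); split; [apply: rO; exact: le_lt_trans pu nr|exists u].
exists p; split=> //; exists u => //.
case: p {Op} pu => p pp /= pu; apply: eq_exist; exact: esym pu.
Qed.

Let grid_isolated (p q : grid_points) (u : int * nat) :
  sval p = (u.1%:~R * h u.2, h u.2) -> p <> q -> h u.2 / 2 <= grid_dist p q.
Proof.
move=> pu pq; rewrite /grid_dist pu /=; have hu := h_gt0 u.2.
have big (a b : R) : h u.2 / 2 <= `|b| -> h u.2 / 2 <= `|a| + `|b|.
  by move=> bb; apply: (le_trans bb); rewrite lerDr.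
have [[_ ->]|[v qv]] := svalP q.
  by apply: big; rewrite subr0 gtr0_norm //; lra.
rewrite qv /=; have [uv|vu|uv] := ltngtP u.2 v.2.
- apply: big; have hv := h_half uv; have hv0 := h_gt0 v.2; rewrite ger0_norm; lra.
- apply: big; have hv := h_half vu; rewrite distrC ger0_norm; lra.
- rewrite -uv subrr normr0 addr0 -mulrBl normrM (gtr0_norm hu) [h u.2 / 2]mulrC.
  rewrite ler_pM2r // -intrB; apply: (@le_trans _ _ 1); first by rewrite invf_le1 // ler1n.
  rewrite -intr_norm -[1]/(1%:~R) ler_int -gtz0_ge1 normr_gt0 subr_eq0.
  apply/eqP => uv1; apply: pq; case: p q pu qv => p pp [q pq] /= pu qv.
  by apply: eq_exist; rewrite pu qv uv1 uv.
Qed.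

(** A grid point at height [h n] has distance at least [h n / 2] to all other
    points, and every point of the axis is approached by the grid. *)
Lemma grid_accumulation : accumulation grid_dist #= S.
Proof.
have accE p : accumulation grid_dist p <-> (sval p).2 = 0.
  split=> [[A cA]|p0].
    have [[_ //]|[u pu]] := svalP p; have [Ainf nA Afin] := cA.
    have hu : 0 < h u.2 / 2 by rewrite divr_gt0.
    case: Ainf; apply: sub_finite_set (Afin (Num.truncn (h u.2 / 2)^-1)) => q Aq.
    have pq : p <> q by move=> e; apply: nA; rewrite e.
    split=> //; rewrite level_leP //; last exact: grid_dist_metric.
    apply: lt_le_trans (grid_isolated pu pq).
    rewrite -[X in _ < X]invrK ltf_pV2 ?posrE ?invr_gt0 //.
    by rewrite real_truncnS_gt // num_real.
  apply: accumulation_exists => n.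
  have [m mn] := h_small (r := n.+1%:R^-1) ltac:(by rewrite invr_gt0).
  have [u pu up] := grid_near p0 m; have pu' : p <> gpt u by exact: nesym.
  exists (gpt u) => //; apply: ltnW; rewrite level_geP //; last exact: grid_dist_metric.
  exact: le_trans pu (ltW mn).
apply: card_eqLR.
  apply: (card_le_intro (f := fun p => (sval p).1)) => [p /accE p0|p q /accE p0 /accE q0].
    have [[]//|[u pu]] := svalP p.
    by move: p0; rewrite pu /= => /eqP; rewrite gt_eqF.
  case: p q p0 q0 => -[a b] pp [[a' b'] qq] /= b0 b0' aa; apply: eq_exist.
  by rewrite aa b0 b0'.
have [[s0 Ss0]|nS] := pselect (S !=set0); last first.
  have -> : S = set0 by apply/seteqP; split=> // s Ss; apply: nS; exists s.
  exact: card_ge0.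
pose axis s : grid_points := if pselect (S s) is left h
  then exist _ (s, 0) (or_introl (conj h erefl))
  else exist _ (s0, 0) (or_introl (conj Ss0 erefl)).
apply: (card_le_intro (f := axis)) => [s Ss|s s' Ss Ss']; rewrite /axis.
  by apply/accE; case: pselect.
by case: pselect => // ?; case: pselect => // ? [].
Qed.
End Grid.

Local Close Scope ring_scope.

(** * Monotone functions between well-orders *)

Section Steps.
Variables (T C : Type) (lt : T -> T -> Prop) (ltc : C -> C -> Prop).
Hypotheses (wo : strict_wo lt) (woc : strict_wo ltc).

Definition nonincreasing_fun (f : T -> C) : Prop := forall t u, lt t u -> ~ ltc (f t) (f u).

(** A list entry [(o, c)] stands for the value [c] up to the next breakpoint [o],
    or for ever if [o] is [None]. *)
Fixpoint step_fun (s : seq (option T * C)) (u : T) : option C :=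
  if s is (o, c) :: s' then
    if o is Some t then if pselect (lt u t) then Some c else step_fun s' u else Some c
  else None.

(** Induction on the value at [t0]: at the first point after [t0] where the value
    changes, it is smaller. *)
Lemma nonincreasing_step (f : T -> C) (t0 : T) : nonincreasing_fun f ->
  exists s, forall u, ~ lt u t0 -> step_fun s u = Some (f u).
Proof.
move=> fmono; move: {2}(f t0) (erefl (f t0)) => c.
elim/(well_founded_ind (strict_wo_wf woc)): c t0 => c IH t0 ft0.
have [ex|nex] := pselect ([set u | ~ lt u t0 /\ f u <> c] !=set0); last first.
  exists [:: (None, c)] => u ut /=; congr Some; apply: contrapT => uc.
  by apply: nex; exists u; split=> //; apply: nesym.
have [t1 [t10 ft1] t1min] := wo.1 _ ex.
have lt1 : ltc (f t1) c.
  have t01 : lt t0 t1.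
    have [e|/(wo.2)[]//] := pselect (t0 = t1); by case: ft1; rewrite -e.
  have := fmono _ _ t01; rewrite ft0 => nc.
  by have [] := woc.2 _ _ ft1.
have [s sP] := IH _ lt1 t1 erefl.
exists ((Some t1, c) :: s) => u ut /=; case: pselect => [ut1|]; last exact: sP.
congr Some; apply: contrapT => uc; apply: (t1min u) => //; split=> //; exact: nesym.
Qed.

Lemma card_nonincreasing_le : [set f | nonincreasing_fun f] #<= [set: seq (option T * C)].
Proof.
have [[t1 _]|nT] := pselect ([set: T] !=set0); last first.
  apply: (card_le_intro (f := fun=> [::])) => // f g _ _ _.
  by apply/funext => t; case: nT; exists t.
have [t0 _ t0min] := wo.1 [set: T] (ex_intro _ t1 I).
have /choice[code codeP] (f : T -> C) : exists s, nonincreasing_fun f ->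
    forall u, step_fun s u = Some (f u).
  have [mf|] := pselect (nonincreasing_fun f); last by exists [::].
  have [s sP] := nonincreasing_step t0 mf; exists s => _ u; apply: sP; exact: t0min.
apply: (card_le_intro (f := code)) => // f g mf mg e.
by apply/funext => u; have := codeP f mf u; rewrite e codeP // => -[].
Qed.
End Steps.

(** * Counting Tukey types *)

Lemma number_of_seq_types_eq (R : realType) (K L : Type) : [set: K] #= [set: L] ->
  number_of_seq_types R K -> number_of_seq_types R L.
Proof.
move=> /card_esym /card_eqTE [f [fi fs]] [t [ti tP]].
exists (t \o f); split=> [k l /ti /fi//|C]; rewrite tP; split=> [[k ->]|[l ->]].
  by have [l <-] := fs k; exists l.
by exists (f l).
Qed.

Lemma number_of_seq_types_unique (R : realType) (K L : Type) :
  number_of_seq_types R K -> number_of_seq_types R L -> [set: K] #= [set: L].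
Proof.
move=> [t [ti tP]] [u [ui uP]].
have /choice[f fP] k : exists l, t k = u l by apply/uP/tP; exists k.
apply/card_eqTE; exists f; split=> [k k' e|l].
  by apply: ti; rewrite !fP e.
have /(tP _)[k ulk] : seq_tukey_type R (u l) by apply/uP; exists l.
by exists k; apply: ui; rewrite -fP.
Qed.

Section Count.
Variable R : realType.

(** The cardinality of a small neighbourhood and, to break ties, thickness;
    [local_lt] is the lexicographic order in which [false] precedes [true]. *)
Definition local_types : Type := (cards R * bool)%type.

Definition local_lt (p q : local_types) : Prop :=
  ~ (sval q.1 #<= sval p.1) \/ (p.1 = q.1 /\ (p.2 = false /\ q.2 = true)).

Lemma strict_wo_local_lt : strict_wo local_lt.
Proof.
have [cmin ctot] := strict_wo_cards R; split=> [A [x Ax]|[S a] [S' b] ne]; last first.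
  have [e|/ctot[h|h]] := pselect (S = S'); [|by left; left|by right; left].
  subst S'; case: a b ne => -[] ne; [by case: ne|by right; right|by left; right|by case: ne].
have [|_ [x1 Ax1 <-] mx1] := cmin (fst @` A); first by exists x.1, x.
have [[y [Ay yx y0]]|ny] := pselect (exists y, [/\ A y, y.1 = x1.1 & y.2 = false]).
  exists y => // z Az [|[_ [_]]]; last by rewrite y0.
  by rewrite yx; apply: mx1; exists z.
exists x1 => // z Az [|[zx [z0 _]]]; first by apply: mx1; exists z.
by apply: ny; exists z.
Qed.

Section Profile.
Variables (X : Type) (d : X -> X -> R).

Definition local_type (x : X) : local_types :=
  (cardinal_of R (small_nbhd d x), `[<thick d x>]).

Definition at_least (u : local_types) : set X :=
  [set x | accumulation d x /\ ~ local_lt (local_type x) u].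

Definition profile (u : local_types) : cards R := cardinal_of R (at_least u).

Hypothesis XR : [set: X] #<= [set: R].

Let leR (A : set X) : A #<= [set: R] := card_le_trans (card_leT A) XR.

Lemma profile_nonincreasing :
  nonincreasing_fun local_lt (fun S T : cards R => ~ (sval T #<= sval S)) profile.
Proof.
move=> t u tu; apply; apply: (card_le_trans (card_eqL (cardinal_ofE (leR _)))).
apply: (card_le_trans _ (card_eqR (cardinal_ofE (leR _)))); apply: subset_card_le.
move=> x [accx xu]; split=> // xt; apply: xu.
exact: strict_wo_trans strict_wo_local_lt xt tu.
Qed.
End Profile.

Lemma local_type_le (X Y : Type) (d : X -> X -> R) (d' : Y -> Y -> R) x y :
  [set: X] #<= [set: R] -> [set: Y] #<= [set: R] -> accumulation d' y ->
  ~ local_lt (local_type d' y) (local_type d x) -> local_le d d' x y.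
Proof.
move=> XR YR accy yx.
have Rx : small_nbhd d x #<= [set: R] := card_le_trans (card_leT _) XR.
have Ry : small_nbhd d' y #<= [set: R] := card_le_trans (card_leT _) YR.
apply: local_le_small => //.
have [xy|nxy] := pselect (small_nbhd d' y #<= small_nbhd d x); [right|by left].
have le : small_nbhd d x #<= small_nbhd d' y.
  apply: contrapT => nle; apply: yx; left => /= h; apply: nle.
  apply: (card_le_trans (card_eqR (cardinal_ofE Rx))); apply: (card_le_trans h).
  exact: card_eqL (cardinal_ofE Ry).
split=> // tx; apply: contrapT => nty; apply: yx; right; split=> /=.
  by apply: cardinal_of_eq => //; exact: card_eqLR.
by split; [exact: asboolF|exact: asboolT].
Qed.

(** The case without accumulation points is separate because it admits no answer
    at all. *)
Lemma profile_tukey_ge (X Y : Type) (d : X -> X -> R) (d' : Y -> Y -> R) :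
  is_metric d -> is_metric d' -> [set: X] #<= [set: R] -> [set: Y] #<= [set: R] ->
  profile d = profile d' -> tukey_ge (sequence_rel d') (sequence_rel d).
Proof.
move=> dm dm' XR YR e.
have le u : at_least d u #= at_least d' u.
  have h1 : at_least d u #<= [set: R] := card_le_trans (card_leT _) XR.
  have h2 : at_least d' u #<= [set: R] := card_le_trans (card_leT _) YR.
  apply: (card_eq_trans (card_esym (cardinal_ofE h1))).
  have -> : cardinal_of R (at_least d u) = cardinal_of R (at_least d' u).
    exact: (congr1 (@^~ u) e).
  exact: cardinal_ofE.
have ne (Z Z' : Type) (b : Z -> Z -> R) (b' : Z' -> Z' -> R) :
    (forall u, at_least b u #<= at_least b' u) ->
    accumulation b !=set0 -> accumulation b' !=set0.
  move=> bb [x accx]; apply: contrapT => nb.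
  have := bb (local_type b x); have -> : at_least b' (local_type b x) = set0.
    by apply/seteqP; split=> // y [accy _]; apply: nb; exists y.
  rewrite card_le0 => /eqP/seteqP[/(_ x)+ _]; apply; split=> //.
  exact: strict_wo_irr strict_wo_local_lt.
have XY := ne _ _ d d' (fun u => card_eqL (le u)).
have YX := ne _ _ d' d (fun u => card_eqR (le u)).
have [accX|nX] := pselect (accumulation d !=set0); last first.
  have noX (p : neg (sequence_rel d)) : False.
    by apply: nX; exists (sval p).1, (sval p).2; exact: (svalP p).
  have noY (p : pos (sequence_rel d')) : False.
    by apply: nX; apply: YX; exists (sval p).1, (sval p).2; exact: (svalP p).
  exists (fun p => match noX p with end), (fun q => match noY q with end) => p.
  by case: (noX p).
have [y0 _] := XY accX.
have [i [iP iinj]] := nested_hall (s := local_type d) (t := local_type d')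
  strict_wo_local_lt (fun u => card_eqL (le u)) y0.
apply: (tukey_ge_sequence_rel dm' dm (i := i)) => // x accx.
by have [acci lti] := iP x accx; split=> //; exact: local_type_le.
Qed.

Record sep_metric : Type := SepMetric {
  sm_space : topologicalType;
  sm_dist : sm_space -> sm_space -> R;
  sm_separable : separable sm_space;
  sm_metrizes : metrizes sm_dist }.

Lemma sm_card_le (M : sep_metric) : [set: sm_space M] #<= [set: R].
Proof. exact: separable_card_le (sm_metrizes M) (sm_separable M). Qed.

Lemma profile_tukey_eq (M N : sep_metric) :
  profile (@sm_dist M) = profile (@sm_dist N) ->
  tukey_eq (seq_rel (sm_space M)) (seq_rel (sm_space N)).
Proof.
move=> e; have [dM tM] := sm_metrizes M; have [dN tN] := sm_metrizes N.
apply: tukey_eq_trans (seq_rel_eq_sequence_rel dM tM) _.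
apply: tukey_eq_trans _ (tukey_eq_sym (seq_rel_eq_sequence_rel dN tN)).
by split; apply: profile_tukey_ge => //; exact: sm_card_le.
Qed.

Lemma tukey_eq_accumulation (M N : sep_metric) :
  tukey_eq (seq_rel (sm_space M)) (seq_rel (sm_space N)) ->
  accumulation (@sm_dist M) #= accumulation (@sm_dist N).
Proof.
have [dM tM] := sm_metrizes M; have [dN tN] := sm_metrizes N => MN.
have [MN1 MN2] : tukey_eq (sequence_rel (@sm_dist M)) (sequence_rel (@sm_dist N)).
  apply: tukey_eq_trans (tukey_eq_sym (seq_rel_eq_sequence_rel dM tM)) _.
  exact: tukey_eq_trans MN (seq_rel_eq_sequence_rel dN tN).
by apply: card_eqLR; apply: accumulation_card_le.
Qed.

Lemma seq_tukey_typeP C : seq_tukey_type R C <->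
  exists M : sep_metric, C = tukey_type (seq_rel (sm_space M)).
Proof.
split=> [[M [sM [d dm dt] ->]]|[M ->]].
  by exists (SepMetric sM (conj dm dt)).
have [dm dt] := sm_metrizes M.
by exists (sm_space M); split; [exact: sm_separable|exists (@sm_dist M)|].
Qed.

Definition grid_sm (S : set R) : sep_metric :=
  SepMetric (@grid_space_separable R S) (metric_space_metrizes (@grid_dist_metric R S)).

(** Spaces form a large type, and so do their Tukey types; the set of the profiles
    of the spaces in a Tukey class is a small code for that class. *)
Let profiles (M : sep_metric) : set (local_types -> cards R) :=
  [set f | exists2 N, f = profile (@sm_dist N) &
    tukey_eq (seq_rel (sm_space M)) (seq_rel (sm_space N))].

Let profiles_eq M N : tukey_eq (seq_rel (sm_space M)) (seq_rel (sm_space N)) ->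
  profiles M = profiles N.
Proof.
move=> MN; apply/seteqP; split=> f [P -> h]; exists P => //.
  exact: tukey_eq_trans (tukey_eq_sym MN) h.
exact: tukey_eq_trans MN h.
Qed.

Let profiles_inj M N : profiles M = profiles N ->
  tukey_eq (seq_rel (sm_space M)) (seq_rel (sm_space N)).
Proof.
move=> e; have : profiles M (profile (@sm_dist M)).
  by exists M => //; split; exists id, id.
rewrite e => -[P /profile_tukey_eq MP NP].
exact: tukey_eq_trans MP (tukey_eq_sym NP).
Qed.

(** At most as many classes as step functions, and at least as many as grid
    spaces with accumulation sets of distinct cardinalities. *)
Lemma number_of_seq_types_cards : number_of_seq_types R (cards R).
Proof.
have Kinf := cards_infinite (@real_infinite R).
pose K := {c | exists M, c = profiles M}.
have /choice[sp spP] (c : K) : exists M, sval c = profiles M by exact: svalP c.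
have KE (c c' : K) : sval c = sval c' -> c = c'.
  by case: c c' => a pa [b pb] /= ab; exact: eq_exist.
apply: (@number_of_seq_types_eq R K); last first.
  exists (fun c => tukey_type (seq_rel (sm_space (sp c)))); split.
    by move=> c c' /tukey_type_inj/profiles_eq e; apply: KE; rewrite !spP.
  move=> C; rewrite seq_tukey_typeP; split=> [[M ->]|[c ->]]; last by exists (sp c).
  exists (exist _ (profiles M) (ex_intro _ M erefl)); apply: tukey_type_eq.
  by apply: profiles_inj; rewrite -spP.
apply: card_eqLR.
  apply: (@card_le_trans _ _ _ [set: seq (option local_types * cards R)]).
    apply: (card_le_trans _
      (card_nonincreasing_le strict_wo_local_lt (strict_wo_cards R))).
    apply: (card_le_intro (f := fun c => profile (@sm_dist (sp c)))).
      by move=> c _; apply: profile_nonincreasing; exact: sm_card_le.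
    by move=> c c' _ _ /profile_tukey_eq/profiles_eq e; apply: KE; rewrite !spP.
  have lt_le : [set: local_types] #<= [set: cards R].
    apply: card_prod_infinite => //.
    apply: (@card_le_trans _ _ _ [set: nat]); last exact/infiniteP.
    by apply/card_leTE; exists nat_of_bool => -[] [].
  have olt : [set: option local_types] #<= [set: cards R].
    apply: (card_le_trans _ (card_option_infinite Kinf)).
    have /card_leTE[f fi] := lt_le.
    by apply/card_leTE; exists (omap f) => -[a|] [b|] //= [/fi ->].
  apply: (card_le_trans _ (card_seq_infinite Kinf)).
  have /card_leTE[f fi] := card_prod_infinite Kinf olt (card_lexx _).
  by apply/card_leTE; exists (map f); exact: inj_map.
pose g (S : cards R) : K := exist _ (profiles (grid_sm (sval S))) (ex_intro _ _ erefl).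
apply/card_leTE; exists g => S T /(congr1 sval) /= /profiles_inj.
move=> /tukey_eq_accumulation ST; apply: cards_inj.
apply: (card_eq_trans (card_esym (@grid_accumulation R (sval S)))).
exact: card_eq_trans ST (@grid_accumulation R (sval T)).
Qed.

End Count.

Theorem theorem4p15 (R : realType) :
  (forall alpha : wellOrder, is_aleph alpha R ->
     number_of_seq_types R (alpha * nat)%type) /\
  (exists K : Type,
     [/\ number_of_seq_types R K, [set: nat] #<= [set: K]
       & [set: K] #<= [set: R]]) /\
  ((exists2 K : Type, number_of_seq_types R K & countable [set: K]) <->
     lt_aleph_omega1 R) /\
  (number_of_seq_types R R <->
     aleph_fixed_point R /\ uncountable_cofinality R) /\
  (exists K : Type,
     [/\ omega1st_aleph_fixed_point K,
         least_cardinal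
           (fun L => aleph_fixed_point L /\ uncountable_cofinality L) K,
         number_of_seq_types R R -> [set: K] #<= [set: R]
       & [set: R] #= [set: K] -> number_of_seq_types R R]).
Proof.
have Rinf := @real_infinite R; have Rcards := number_of_seq_types_cards R.
have types_R : number_of_seq_types R R <->
    aleph_fixed_point R /\ uncountable_cofinality R.
  split=> [RR|[/aleph_fixed_pointP[_ RiR] _]].
    split; last exact: real_uncountable_cofinality.
    apply: fixed_point_cards; first exact: real_uncountable.
    exact: card_eqL (number_of_seq_types_unique RR Rcards).
  apply: number_of_seq_types_eq Rcards; apply: card_eqLR; first exact: card_cards_le.
  exact: card_le_trans RiR (icards_le_cards R).
split; [|split; [|split; [|split=> //]]].
- move=> alpha Ralpha; apply: number_of_seq_types_eq Rcards; apply: card_esym.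
  apply: cards_aleph => //; apply: contrapT => na.
  have [F [_ [_ Rmin]]] := Ralpha; apply: (@real_uncountable R); apply: Rmin.
  by split; [exact: infinite_nat|move=> a; case: na].
- exists (cards R); split=> //; last exact: card_cards_le.
  exact/infiniteP/cards_infinite.
- rewrite -countable_cards_aleph_omega1 //; split=> [[K RK Kc]|Rc]; last by exists (cards R).
  exact: card_le_trans (card_eqR (number_of_seq_types_unique RK Rcards)) Kc.
have [K [K1 Kleast]] := omega1st_aleph_fixed_pointP.
exists K; split=> // [/types_R|RK]; first exact: Kleast.2.
apply/types_R; have [Kfix Kcof] := Kleast.1; split.
  exact: aleph_fixed_point_eq (card_esym RK) Kfix.
exact: uncountable_cofinality_eq (card_esym RK) Kcof.
Qed.
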